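(* Let $D$ be a knot diagram with all-$A$ ribbon graph $\mathbb{G}$. For integers $u,v$ let $\mathcal{C}_v^u(\mathbb{G})$ be the free abelian group generated by the quasi-trees $\mathbb{Q}$ of $\mathbb{G}$ with $u(\mathbb{Q})=u$ and $v(\mathbb{Q})=v$, and $\mathcal{C}(\mathbb{G})=\bigoplus_{u,v}\mathcal{C}_v^u(\mathbb{G})$. Then there is a differential $\partial:\mathcal{C}_v^u\to\mathcal{C}_{v-1}^{u-1}$ making $\mathcal{C}(\mathbb{G})=\{\mathcal{C}_v^u(\mathbb{G}),\partial\}$ a chain complex that is a deformation retract of the reduced Khovanov complex of $D$. In particular, $$\widetilde{H}^{i,j}(D;\mathbb{Z})\cong H_v^u(\mathcal{C}(\mathbb{G});\mathbb{Z})$$ where $u=j-i-w(D)+1$ and $v=j/2-i+(V(\mathbb{G})-c_+(D))/2$, with $w(D)$ the writhe of $D$, $c_+(D)$ the number of positive crossings of $D$, and $V(\mathbb{G})$ the number of vertices of $\mathbb{G}$ (the number of circles in the all-$A$ state of $D$).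
   Context: $\widetilde{H}^{i,j}(D;\mathbb{Z})$ denotes reduced Khovanov homology with homological grading $i$ and quantum grading $j$. Each crossing of $D$ has an $A$-smoothing and a $B$-smoothing (Kauffman's convention); the all-$A$ state smooths every crossing by $A$. Number the crossings $1,\dots,n$. Half-edges and permutations: position crossing $i$ with strands parallel to $y=\pm x$, and mark half-edges $2i-1$ and $2i$ on the all-$A$ state circles near the crossing in the half-planes $y>x$ and $y<x$. Orient each all-$A$ state circle counterclockwise if nested in an even number of other state circles, clockwise otherwise (positive direction). $\sigma_0$ sends each mark to the next mark in the positive direction on its circle; $\sigma_1=\prod_i(2i-1,\,2i)$; $\sigma_2=\sigma_1\circ\sigma_0^{-1}$. The all-$A$ ribbon graph $\mathbb{G}$ has vertices the $\sigma_0$-orbits (all-$A$ state circles), edges the $\sigma_1$-orbits (edge $i=\{2i-1,2i\}$, one per crossing), cyclic orders given by $\sigma_0$; as a surface it is one disk per vertex and one untwisted band per edge, orientable. A spanning subgraph has all vertices of $\mathbb{G}$ and a subset of its edges; its faces are the boundary components of the surface of vertex disks and bands of its edges. A quasi-tree is a spanning subgraph $\mathbb{Q}$ with exactly one face; its genus is $g(\mathbb{Q})=(1-V(\mathbb{Q})+E(\mathbb{Q}))/2$. For a quasi-tree $\mathbb{Q}$, let $\sigma(i)=\sigma_0(i)$ if half-edge $i$ is not in $\mathbb{Q}$ and $\sigma(i)=\sigma_2^{-1}(i)$ if it is; $C_{\mathbb{Q}}$ is the ordered chord diagram: a circle with marks $1,\dots,2n$ placed consecutively in the order given by $\sigma$,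 with chord $i$ joining $2i-1$ and $2i$. Chords are totally ordered by $i$ (i.e. by $\min(2i-1,2i)$); two chords intersect if their endpoints interleave on the circle. A chord (and the corresponding edge of $\mathbb{G}$) is live with respect to $\mathbb{Q}$ if it intersects no lower-ordered chord. Define $u(\mathbb{Q})=\#\{\text{live edges not in }\mathbb{Q}\}-\#\{\text{live edges in }\mathbb{Q}\}$ and $v(\mathbb{Q})=-g(\mathbb{Q})$. *)

(* Defs.v *)
From mathcomp Require Import all_boot all_order all_algebra.
Set Implicit Arguments.
Unset Strict Implicit.
Unset Printing Implicit Defensive.
Import Order.TTheory GRing.Theory Num.Theory.
Local Open Scope ring_scope.

(* A map M : A -> B -> int sends basis element a to \sum_b M a b * b.   *)

Definition lapp (A B : finType) (M : A -> B -> int) (x : {ffun A -> int})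
  : {ffun B -> int} := [ffun b => \sum_a x a * M a b].

Definition lcomp (A B C : finType) (M : A -> B -> int) (N : B -> C -> int)
  : A -> C -> int := fun a c => \sum_b M a b * N b c.

Definition is_cycle (A : finType) (d : A -> A -> int) (P : pred A)
  (x : {ffun A -> int}) : Prop :=
  (forall a, ~~ P a -> x a = 0) /\ lapp d x = 0.

Definition is_boundary (A : finType) (d : A -> A -> int)
  (x : {ffun A -> int}) : Prop := exists y, x = lapp d y.

Definition homology_iso (A : finType) (dA : A -> A -> int) (PA : pred A)
  (B : finType) (dB : B -> B -> int) (PB : pred B) : Prop :=
  exists (P : A -> B -> int) (Q : B -> A -> int),
    (forall x, is_cycle dA PA x -> is_cycle dB PB (lapp P x)) /\
    (forall y, is_cycle dB PB y -> is_cycle dA PA (lapp Q y)) /\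
    (forall x, is_cycle dA PA x -> is_boundary dA x ->
               is_boundary dB (lapp P x)) /\
    (forall y, is_cycle dB PB y -> is_boundary dB y ->
               is_boundary dA (lapp Q y)) /\
    (forall x, is_cycle dA PA x -> is_boundary dA (lapp Q (lapp P x) - x)) /\
    (forall y, is_cycle dB PB y -> is_boundary dB (lapp P (lapp Q y) - y)).

Definition deformation_retract (C K : finType) (dC : C -> C -> int)
  (dK : K -> K -> int) (corr : C -> K -> bool) (hdeg : K -> K -> bool) : Prop :=
  exists (f : C -> K -> int) (g : K -> C -> int) (h : K -> K -> int),
    (forall a x, f a x != 0 -> corr a x) /\
    (forall x a, g x a != 0 -> corr a x) /\
    (forall x y, h x y != 0 -> hdeg x y) /\
    (forall a x, lcomp f dK a x = lcomp dC f a x) /\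
    (forall x a, lcomp dK g x a = lcomp g dC x a) /\
    (forall a a', lcomp f g a a' = (a == a')%:R) /\
    (forall x y, lcomp g f x y - (x == y)%:R
                 = lcomp dK h x y + lcomp h dK x y).

Definition nclasses (T : finType) (r : rel T) : nat :=
  #|[set [set y | connect r x y] | x : T]|.
Definition norbits (T : finType) (f : T -> T) : nat := nclasses (frel f).

(* Darts: (i,k) = k-th endpoint (k = 0..3, counterclockwise) of the     *)
(* edges at crossing i.  Positions 0,2 are the under strand, 1,3 the    *)
(* over strand; the under strand enters at 0 and leaves at 2.           *)

Definition dart (n : nat) := ('I_n * 'I_4)%type.

Record knot_diagram (n : nat) := KnotDiagram {
  kd_edge : dart n -> dart n;  (* the other endpoint of the edge       *)
  kd_pos : 'I_n -> bool;       (* true: over strand enters at 3 (then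
                                  the crossing is positive); false: it
                                  enters at 1 (negative crossing)      *)
  kd_outer : dart n            (* a corner of the unbounded face       *)
}.

Definition i4 (m : nat) : 'I_4 := inord (m %% 4).

Definition drot n (d : dart n) : dart n := (d.1, i4 (d.2 + 1)%N).
Definition dopp n (d : dart n) : dart n := (d.1, i4 (d.2 + 2)%N).

Section Diagram.
Variables (n : nat) (D : knot_diagram n).
Local Notation e := (kd_edge D).

Definition incoming (d : dart n) : bool :=
  (d.2 == 0 :> nat) || (d.2 == (if kd_pos D d.1 then 3 else 1)%N :> nat).

(* face permutation: corner (i,k) = corner between darts k and k+1 *)
Definition dface (d : dart n) : dart n := e (drot d).
Definition dstrand (d : dart n) : dart n := e (dopp d).

Definition is_knot_diagram : Prop :=
  [/\ forall d, e (e d) = d,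
      forall d, e d != d,
      forall d, incoming (e d) = ~~ incoming d,
      (* one component *)
      forall d d', incoming d -> incoming d' -> fconnect dstrand d d' &
      (* planarity (connected, Euler characteristic 2): F = n + 2 *)
      norbits dface = (n + 2)%N].

(* checkerboard colouring of the faces; the unbounded face is white
   (false); black (true) faces = odd depth *)
Definition checkerboard (c : dart n -> bool) : Prop :=
  [/\ forall d, c (dface d) = c d,
      forall d, c (drot d) = ~~ c d &
      c (kd_outer D) = false].

Definition nplus : nat := #|[set i | kd_pos D i]|.
Definition nminus : nat := (n - nplus)%N.
Definition writhe : int := nplus%:Z - nminus%:Z.

(* A-smoothing joins positions 0-1 and 2-3; B-smoothing 1-2 and 3-0.   *)
Definition partnerA (k : 'I_4) : 'I_4 :=
  i4 (match val k with 0 => 1 | 1 => 0 | 2 => 3 | _ => 2 end)%N.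
Definition partnerB (k : 'I_4) : 'I_4 := i4 (3 - k)%N.

(* a state = set of B-smoothed crossings (Khovanov's 1-resolutions) *)
Definition sjoin (s : {set 'I_n}) (d : dart n) : dart n :=
  (d.1, if d.1 \in s then partnerB d.2 else partnerA d.2).

Definition srel (s : {set 'I_n}) : rel (dart n) :=
  fun d d' => (d' == e d) || (d' == sjoin s d).

Definition scircle (s : {set 'I_n}) (d : dart n) : {set dart n} :=
  [set d' | connect (srel s) d d'].
Definition scircles (s : {set 'I_n}) := [set scircle s d | d : dart n].

(* an enhancement = set X of darts lying on circles labelled v_+ (1);
   circles not meeting X are labelled v_- (x) *)
Definition enh_ok (s : {set 'I_n}) (X : {set dart n}) : bool :=
  [forall d, forall d', srel s d d' ==> ((d \in X) == (d' \in X))].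

Definition qdeg (s : {set 'I_n}) (X : {set dart n}) : int :=
  2%:Z * #|[set scircle s d | d in X]|%:Z - #|scircles s|%:Z.

(* Generators of the reduced Khovanov complex w.r.t. basepoint b: the
   circle through b is labelled x. *)
Definition khgen (b : dart n) :=
  {p : {set 'I_n} * {set dart n} | enh_ok p.1 p.2 && (b \notin p.2)}.

Definition khi (b : dart n) (x : khgen b) : int :=
  #|(val x).1|%:Z - nminus%:Z.
Definition khj (b : dart n) (x : khgen b) : int :=
  qdeg (val x).1 (val x).2 + #|(val x).1|%:Z + nplus%:Z - 2%:Z * nminus%:Z.

Definition affected (s : {set 'I_n}) (c : 'I_n) : {set dart n} :=
  [set d | [exists k : 'I_4, connect (srel s) (c, k) d]].

(* Khovanov differential: edge of the cube s -> s + c, with the maps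
   m : 1@1->1, 1@x->x, x@1->x, x@x->0 ; Delta : 1->1@x+x@1, x->x@x,
   which are exactly: labels off the affected circles unchanged and
   quantum degree qdeg drops by one; sign (-1)^#{c' in s, c' < c}. *)
Definition khd (b : dart n) (x y : khgen b) : int :=
  let s := (val x).1 in let X := (val x).2 in
  let s' := (val y).1 in let X' := (val y).2 in
  match [pick c | (c \notin s) && (s' == c |: s)] with
  | Some c =>
      if (X :\: affected s c == X' :\: affected s c)
         && (qdeg s' X' == qdeg s X - 1)
      then (-1) ^+ #|[set c' in s | (c' < c)%N]|
      else 0
  | None => 0
  end.

(* Half-edges (marks): (i,false) on the A-arc joining positions 0,1 of
   crossing i, (i,true) on the A-arc joining positions 2,3.  Chord/edge i
   consists of (i,false),(i,true). *)
Definition hedge := ('I_n * bool)%type.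

Variable c : dart n -> bool.

(* colour of the region between the two A-arcs at crossing i (it
   contains the corner between positions 1 and 2) *)
Definition midcol (i : 'I_n) : bool := c (i, i4 1).

(* traversing the A-arc from position 0 to 1 (or 2 to 3) keeps the
   middle region on the left; positive direction = odd-depth (black)
   region on the left *)
Definition hentry (h : hedge) : dart n :=
  (h.1, i4 ((if h.2 then 2 else 0) + (if midcol h.1 then 0 else 1))%N).
Definition hexit (h : hedge) : dart n := (h.1, partnerA (hentry h).2).
Definition arc_of (d : dart n) : hedge := (d.1, (2 <= d.2)%N).

Definition sigma0 (h : hedge) : hedge := arc_of (e (hexit h)).

Definition nvert : nat := norbits sigma0.

(* sigma for a spanning subgraph Q: sigma0 on half-edges not in Q,
   sigma2^-1 = sigma0 o sigma1 on half-edges in Q *)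
Definition sigma1 (h : hedge) : hedge := (h.1, ~~ h.2).
Definition sigmaQ (Q : {set 'I_n}) (h : hedge) : hedge :=
  if h.1 \in Q then sigma0 (sigma1 h) else sigma0 h.

Definition nfaces (Q : {set 'I_n}) : nat := norbits (sigmaQ Q).
Definition quasi_tree (Q : {set 'I_n}) : bool := nfaces Q == 1%N.

Definition genus (Q : {set 'I_n}) : int :=
  ((1 - nvert%:Z + #|Q|%:Z) %/ 2)%Z.

(* chord a and chord b interleave on the circle ordered by sigmaQ *)
Definition chords_cross (Q : {set 'I_n}) (a b : 'I_n) : bool :=
  let x1 := (a, false) in
  let k := findex (sigmaQ Q) x1 (a, true) in
  (findex (sigmaQ Q) x1 (b, false) < k)%N
    != (findex (sigmaQ Q) x1 (b, true) < k)%N.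

Definition live (Q : {set 'I_n}) (a : 'I_n) : bool :=
  [forall b : 'I_n, (b < a)%N ==> ~~ chords_cross Q a b].

Definition qt_u (Q : {set 'I_n}) : int :=
  #|[set a | live Q a & a \notin Q]|%:Z - #|[set a | live Q a & a \in Q]|%:Z.
Definition qt_v (Q : {set 'I_n}) : int := - genus Q.

Definition qtree := {Q : {set 'I_n} | quasi_tree Q}.

Definition qu (Q : qtree) : int := qt_u (val Q).
Definition qv (Q : qtree) : int := qt_v (val Q).

Definition deg_corr (u v i j : int) : bool :=
  (u == j - i - writhe + 1) &&
  (2%:Z * v == j - 2%:Z * i + nvert%:Z - nplus%:Z).

End Diagram.

(* Main.v *)
Require Import Defs.
From mathcomp Require Import all_boot all_order all_fingroup all_algebra.
From mathcomp Require Import zify ring.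

(* The circles of a state s are the cycles of one permutation of the half-edges,
   and changing the smoothing at a crossing multiplies it by a transposition; by
   the checkerboard colouring all states are oriented coherently, so this always
   splits or merges cycles.  A quasi-tree is a state with a single circle.  Every
   state s differs from exactly one quasi-tree Q only at live edges of Q, so the
   cube of states is partitioned into intervals, and edges of the cube between
   distinct intervals increase Q in the order reading edges from the highest
   down.  Live chords do not cross, so in the interval of Q each flipped live
   edge a splits off one circle, and a generator amounts to saying for each live
   edge whether it is flipped and, if so, the label (1 or x) of that circle.
   For a outside Q the unflipped state is matched with label x, for a in Q label 1
   is matched with the unflipped state; the generator where every live edge is
   flipped and carries the remaining label is critical.  A Khovanov term inside
   the interval either realises such a match at one edge or transfers an x
   between a circle and its parent; weighting unmatched edges by the size of the
   region cut off shows that the matching is acyclic.  Gaussian elimination of the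
   matched pairs leaves one generator per quasi-tree. *)
Set Implicit Arguments.
Unset Strict Implicit.
Unset Printing Implicit Defensive.
Import Order.TTheory GRing.Theory Num.Theory.
Local Open Scope ring_scope.

(** * Gaussian elimination along an acyclic matching *)

(** Maps act on row vectors, so composites are written in the order of application. The highest edge
    where two quasi-trees differ is live for neither, so each state agrees there with its own
    quasi-tree; a cube edge can therefore leave an interval only by adding this highest edge. Inside
    an interval the circles form a tree rooted at the base circle. The base circle is always x and
    cannot take part in a transfer, so the parent of the circle of [c] is then the circle of another
    live edge [a], whose region properly contains that of [c]. Regions count positively outside [Q]
    and negatively inside, because a transfer then changes the weight by the size of the region of
    [a] minus that of [c] in all four cases. Any noncritical live edge may serve as pivot: both
    generators of a pair have the same set of them, so a choice depending only on that set is an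
    involution. *)

Lemma nilpotent_inverse (R : pzRingType) (N : R) (m : nat) :
  N ^+ m = 0 ->
  exists T : R, [/\ (1 + N) * T = 1, T * (1 + N) = 1 &
    forall P : R, GRing.comm P N -> GRing.comm P T].
Proof.
move=> Nm0; pose T := \sum_(i < m) (- N) ^+ i.
(* [T] is a polynomial in [N]; this clause later carries gradings from [N] to [T]. *)
have cT (P : R) : GRing.comm P N -> GRing.comm P T.
  by move=> cPN; apply: commr_sum => i _; apply: commrX; apply: commrN.
have N1 : (1 + N) * T = 1.
  have := subrX1 (- N) m; rewrite exprNn Nm0 mulr0 sub0r => /(congr1 -%R).
  by rewrite opprK -mulNr opprB opprK => <-.
exists T; split=> //.
rewrite -[RHS]N1; apply/esym/cT/commr_sym.
by apply: commrD; [exact: commr1 | exact: commr_refl].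
Qed.

Section BlockInverse.
Variables (R : pzRingType) (d PA PB W V N : R) (m : nat).
Hypotheses (PBW : PB * W = W) (WPA : W * PA = W) (PAV : PA * V = V).
Hypothesis WV : W * V = PB.
Hypotheses (PANE : PA * N = N) (NPAE : N * PA = N) (Nm0 : N ^+ m = 0).
Hypothesis dWE : PA * d * W = PA + N.

(** The block [PA * d * PB] factors as [(1 + N) * V], with [V] the matched part of [d] and [W] its
    inverse. Inverting the unipotent factor makes [W * T] a two-sided inverse of the block. *)
Lemma block_inverse : exists T : R,
  let G := W * T in
  [/\ forall P : R, GRing.comm P N -> GRing.comm P T,
      PB * G = G, G * PA = G, PA * d * G = PA & G * d * PB = PB].
Proof.
have [T [N1 N2 cT]] := nilpotent_inverse Nm0.
have cPA : PA * T = T * PA by apply: cT; rewrite /GRing.comm PANE NPAE.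
have VPB : PA * d * PB = (1 + N) * V.
  by rewrite -WV !mulrA dWE -{1}[N]NPAE -{1}[PA]mul1r -mulrDl -mulrA PAV.
exists T; split=> //; rewrite ?mulrA ?PBW //.
- by rewrite -mulrA -cPA mulrA WPA.
- by rewrite dWE -{1}[N]PANE -{1}[PA]mulr1 -mulrDr -mulrA N1 mulr1.
- rewrite -{1}WPA -[W * PA * T]mulrA cPA -!mulrA (mulrA PA) VPB (mulrA T) N2.
  by rewrite mul1r.
Qed.

End BlockInverse.

Section GaussProjector.
Variables (R : pzRingType) (d G PA PB : R).
Hypotheses (dd : d * d = 0) (PAPB : PA * PB = 0).
Hypotheses (PBG : PB * G = G) (GPA : G * PA = G).
Hypotheses (PAdG : PA * d * G = PA) (GdPB : G * d * PB = PB).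

(** Homotopic to the identity by construction. As [G] inverts the matched block, the map is
    idempotent, vanishes on the sources of the matching and has no component on its targets. *)
Definition gauss_proj : R := 1 - d * G - G * d.
Local Notation P := gauss_proj.

Lemma gauss_GG : G * G = 0.
Proof. by rewrite -{1}GPA -PBG -mulrA (mulrA PA) PAPB mul0r mulr0. Qed.

Lemma gauss_GdG : G * d * G = G.
Proof. by rewrite -{2}PBG mulrA GdPB PBG. Qed.

Lemma gauss_PAP : PA * P = 0.
Proof.
by rewrite !mulrBr mulr1 !mulrA PAdG subrr sub0r -PBG mulrA PAPB !mul0r oppr0.
Qed.

Lemma gauss_PPB : P * PB = 0.
Proof.
rewrite !mulrBl mul1r GdPB -{1}GPA -!mulrA PAPB !mulr0 subr0.
by rewrite subrr.
Qed.

Lemma gauss_Pd : P * d = d - d * G * d.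
Proof. by rewrite !mulrBl mul1r -[G * d * d]mulrA dd mulr0 subr0. Qed.

Lemma gauss_dP : d * P = P * d.
Proof. by rewrite gauss_Pd !mulrBr mulr1 !mulrA dd mul0r subr0. Qed.

Lemma gauss_PG : P * G = 0.
Proof.
rewrite !mulrBl mul1r gauss_GdG -mulrA gauss_GG mulr0 subr0.
by rewrite subrr.
Qed.

Lemma gauss_PP : P * P = P.
Proof.
rewrite {2}/gauss_proj !mulrBr mulr1 !mulrA gauss_PG mul0r subr0.
by rewrite -gauss_dP -mulrA gauss_PG mulr0 subr0.
Qed.

End GaussProjector.

(** * Integer kernels as matrices *)

Section FunMatrix.

Definition fmx (A B : finType) (M : A -> B -> int) : 'M[int]_(#|A|, #|B|) :=
  \matrix_(i, j) M (enum_val i) (enum_val j).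

Lemma fmxE (A B : finType) (M : A -> B -> int) a b :
  fmx M (enum_rank a) (enum_rank b) = M a b.
Proof. by rewrite mxE !enum_rankK. Qed.

Lemma fmx_comp (A B C : finType) (M : A -> B -> int) (N : B -> C -> int) :
  fmx (lcomp M N) = fmx M *m fmx N.
Proof.
apply/matrixP=> i j; rewrite !mxE /lcomp.
rewrite (reindex (fun k : 'I_#|B| => enum_val k)) /=; last first.
  by apply: onW_bij; apply: enum_val_bij.
by apply: eq_bigr => k _; rewrite !mxE.
Qed.

Lemma fmxP (A B : finType) (M N : A -> B -> int) :
  fmx M = fmx N <-> (forall a b, M a b = N a b).
Proof.
split=> [E a b | E]; first by rewrite -fmxE E fmxE.
by apply/matrixP=> i j; rewrite !mxE E.
Qed.

Lemma lcomp_neq0 (A B C : finType) (M : A -> B -> int) (N : B -> C -> int) a c :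
  lcomp M N a c != 0 -> exists b, M a b != 0 /\ N b c != 0.
Proof.
have [/existsP[b /andP[Mb Nb]] _ | ] :=
  boolP [exists b, (M a b != 0) && (N b c != 0)]; first by exists b.
rewrite negb_exists => /forallP H /eqP[].
apply: big1 => b _; have := H b; rewrite -negb_or negbK => /orP[] /eqP-> //.
  by rewrite mul0r.
by rewrite mulr0.
Qed.

Lemma fmx_selectl (K : finType) (Q : pred K) (M : K -> K -> int) :
  fmx (fun x y => (Q x && (x == y))%:R) *m fmx M = fmx (fun x y => if Q x then M x y else 0).
Proof.
rewrite -fmx_comp; apply/fmxP => x y; rewrite /lcomp.
rewrite (bigD1 x) //= eqxx andbT big1 => [|z /negPf zx].
  by case: ifP; rewrite ?mul1r ?mul0r addr0.
by rewrite eq_sym zx andbF mul0r.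
Qed.

Lemma fmx_selectr (K : finType) (Q : pred K) (M : K -> K -> int) :
  fmx M *m fmx (fun x y => (Q x && (x == y))%:R) = fmx (fun x y => if Q y then M x y else 0).
Proof.
rewrite -fmx_comp; apply/fmxP => x y; rewrite /lcomp.
rewrite (bigD1 y) //= eqxx andbT big1 => [|z /negPf zx].
  by case: ifP; rewrite ?mulr1 ?mulr0 addr0.
by rewrite zx andbF mulr0.
Qed.

End FunMatrix.

(** * Retraction onto the critical generators of a matching *)

Section Morse.
Variables (C K : finType) (d : K -> K -> int) (A B : pred K) (mu : K -> K).
Variables (crit : C -> K) (lt : rel K) (V : zmodType) (deg : K -> V) (dl : V).
Hypothesis dd : forall x y, lcomp d d x y = 0.
Hypothesis AB : forall x, A x -> B x = false.
Hypothesis muA : forall x, A x -> B (mu x).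
Hypothesis muB : forall x, B x -> A (mu x).
Hypothesis muK : forall x, A x || B x -> mu (mu x) = x.
Hypothesis dmu : forall x, A x -> d x (mu x) * d x (mu x) = 1.
Hypothesis lt_irr : forall x, lt x x = false.
Hypothesis lt_tr : forall x y z, lt x y -> lt y z -> lt x z.
Hypothesis d_lt : forall x y, A x -> B y -> d x y != 0 -> y = mu x \/ lt x (mu y).
Hypothesis crit_inj : injective crit.
Hypothesis critP : forall x, reflect (exists a, crit a = x) (~~ A x && ~~ B x).
Hypothesis d_deg : forall x y, d x y != 0 -> deg y = deg x + dl.

Let n := #|K|.
Let dm : 'M[int]_n := fmx d.
Let PA : 'M[int]_n := fmx (fun x y => (A x && (x == y))%:R).
Let PB : 'M[int]_n := fmx (fun x y => (B x && (x == y))%:R).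
Let W : 'M[int]_n := fmx (fun x y => if B x && (y == mu x) then d y x else 0).
Let VV : 'M[int]_n := fmx (fun x y => if A x && (y == mu x) then d x y else 0).
Let N : 'M[int]_n := PA *m dm *m W - PA.

Lemma morse_sum1 (F : K -> int) z : \sum_(y : K) (if y == z then F y else 0) = F z.
Proof. by rewrite -big_mkcond big_pred1_eq. Qed.

(** One zigzag: from [x] to the target [mu y], then back along the matched pair to [y]. The
    coefficient [d y (mu y)] has square 1 and so is its own inverse. *)
Definition morse_N (x y : K) : int :=
  if [&& A x, A y & x != y] then d x (mu y) * d y (mu y) else 0.

Lemma morse_NE : N = fmx morse_N.
Proof.
rewrite /N fmx_selectl -fmx_comp; apply/matrixP=> i j.
rewrite !mxE; move: (enum_val i) (enum_val j) => x y {i j}.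
rewrite /lcomp /morse_N; have [Ax|nAx] := boolP (A x); last first.
  by rewrite /= big1 ?subrr // => z _; rewrite mul0r.
have [Ay|nAy] /= := boolP (A y); last first.
  rewrite big1 ?sub0r => [|z _].
    by case: eqP => [E|]; rewrite ?oppr0 //; rewrite -E Ax in nAy.
  case: ifP => [/andP[Bz /eqP yz]|]; last by rewrite mulr0.
  by rewrite yz muB in nAy.
rewrite (bigD1 (mu y)) //= muA // muK ?Ay // eqxx big1 ?addr0 => [|z zy].
  case: eqVneq => [<-|_] /=; last by rewrite subr0.
  by rewrite dmu // subrr.
case: ifP => [/andP[Bz /eqP yz]|]; last by rewrite mulr0.
by rewrite yz muK ?Bz ?orbT ?eqxx in zy.
Qed.

Lemma morse_N_neq0 x y : morse_N x y != 0 -> lt x y /\ deg x = deg y.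
Proof.
rewrite /morse_N; case: ifP => [/and3P[Ax Ay xy] | ]; last by rewrite eqxx.
rewrite mulf_eq0 negb_or => /andP[d1 d2]; split.
  case: (d_lt Ax (muA Ay) d1) => [E|]; last by rewrite muK // Ay.
  by move: xy; rewrite -[x]muK ?Ax // -E muK ?Ay // eqxx.
by apply: (addIr dl); rewrite -(d_deg d1) -(d_deg d2).
Qed.

Definition morse_height x := #|[set z | lt x z]|.

Lemma morse_height_lt x y : lt x y -> (morse_height y < morse_height x)%N.
Proof.
move=> xy; apply: proper_card; apply/properP; split.
  by apply/subsetP=> z; rewrite !inE; apply: lt_tr.
by exists y; rewrite !inE ?lt_irr.
Qed.

(** Each zigzag goes up in [lt] and strictly lowers [morse_height], which is at most [#|K|]; hence
    [N] is nilpotent. *)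
Lemma morse_Npow m x y :
  (N ^+ m : 'M[int]_n) (enum_rank x) (enum_rank y) != 0 ->
  (morse_height y + m <= morse_height x)%N /\ deg x = deg y.
Proof.
elim: m x y => [|m IH] x y.
  rewrite expr0 mxE (inj_eq enum_rank_inj).
  by case: (eqVneq x y) => [->|] //=; rewrite addn0.
rewrite exprS -mulmxE mxE => H.
have [z Hz] : exists z, morse_N x z != 0 /\
    (N ^+ m : 'M[int]_n) (enum_rank z) (enum_rank y) != 0.
  apply: (@lcomp_neq0 _ _ _ morse_N
    (fun z y => (N ^+ m : 'M[int]_n) (enum_rank z) (enum_rank y))).
  move: H; apply: contraNneq => E0; apply/eqP; rewrite -[RHS]E0.
  rewrite /lcomp [RHS](reindex (fun k : 'I_#|K| => enum_val k)) /=; last first.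
    by apply: onW_bij; apply: enum_val_bij.
  by apply: eq_bigr => k _; rewrite enum_valK morse_NE mxE enum_rankK.
have [/morse_N_neq0[/morse_height_lt lt1 ->] /IH[le2 ->]] := Hz.
by split=> //; rewrite addnS; apply: leq_ltn_trans le2 lt1.
Qed.

Lemma morse_inverse : exists G : K -> K -> int,
  [/\ PB *m fmx G = fmx G, fmx G *m PA = fmx G,
      PA *m dm *m fmx G = PA, fmx G *m dm *m PB = PB &
      forall x y, G x y != 0 -> deg y = deg x - dl].
Proof.
have Nn0 : N ^+ #|K|.+1 = 0.
  apply/matrixP=> i j; rewrite !mxE -[i]enum_valK -[j]enum_valK.
  apply/eqP/negPn/negP => /morse_Npow[].
  have : (morse_height (enum_val i) <= #|K|)%N by rewrite max_card.
  by move=> h1 h2; have := leq_trans h2 h1; rewrite addnS ltnNge leq_addl.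
have PBW : PB *m W = W.
  by rewrite fmx_selectl; apply/fmxP => x y; case: (B x).
have WPA : W *m PA = W.
  rewrite fmx_selectr; apply/fmxP => x y.
  by case: ifP => // nA; case: ifP => // /andP[Bx /eqP yx]; rewrite yx muB in nA.
have PAV : PA *m VV = VV.
  by rewrite fmx_selectl; apply/fmxP => x y; case: (A x).
have WV : W *m VV = PB.
  rewrite -fmx_comp; apply/fmxP => x y; rewrite /lcomp.
  rewrite (eq_bigr (fun z => if z == mu x then
      (B x && (x == y))%:R else 0)) ?morse_sum1 // => z _.
  case: (boolP (B x)) => Bx /=; last by rewrite mul0r if_same.
  case: eqVneq => [-> | _]; last by rewrite mul0r.
  rewrite muB // muK ?Bx ?orbT // eq_sym; case: eqVneq => [<- | _] /=.
    by have := dmu (muB Bx); rewrite muK ?Bx ?orbT.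
  by rewrite mulr0.
have NA : (PA *m N = N) * (N *m PA = N).
  rewrite morse_NE fmx_selectl fmx_selectr.
  by split; apply/fmxP => x y; rewrite /morse_N; case: (A x); case: (A y).
have dWE : PA *m dm *m W = PA + N by rewrite addrC subrK.
have [T [cT BG GA dG Gd]] := block_inverse PBW WPA PAV WV NA.1 NA.2 Nn0 dWE.
(* [T] commutes with the projection to each degree because [N] does. *)
have Tdeg x y : T (enum_rank x) (enum_rank y) != 0 -> deg x = deg y.
  pose t u v : int := T (enum_rank u) (enum_rank v).
  pose D := fmx (fun u v => ((deg u == deg x) && (u == v))%:R).
  have TE : T = fmx t by apply/matrixP=> i j; rewrite mxE /t !enum_valK.
  have : GRing.comm D T.
    apply: cT; rewrite /GRing.comm -mulmxE morse_NE fmx_selectl fmx_selectr.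
    apply/fmxP => u v; have [-> | /morse_N_neq0[_ ->] //] := eqVneq (morse_N u v) 0.
    by rewrite !if_same.
  rewrite /GRing.comm -mulmxE TE fmx_selectl fmx_selectr fmxE => /fmxP/(_ x y).
  by rewrite eqxx; case: eqP => // _ ->; rewrite eqxx.
pose w (x y : K) : int := if B x && (y == mu x) then d y x else 0.
pose t u v : int := T (enum_rank u) (enum_rank v).
have GE : W *m T = fmx (lcomp w t).
  rewrite fmx_comp; congr (_ *m _).
  by apply/matrixP=> i j; rewrite mxE /t !enum_valK.
exists (lcomp w t); rewrite -GE; split=> // x y /lcomp_neq0[z [wz /Tdeg <-]].
move: wz; rewrite /w; case: ifP; rewrite ?eqxx // => /andP[Bx /eqP zE] /d_deg->.
by rewrite addrK.
Qed.

(** With [E] the inclusion of the critical generators and [P] the projector, take [f = E P],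
    [g = P E^T] and [dC = f d g]. The identities rest on [E P E^T = 1] and on [P E^T E P = P], the
    latter because [E^T E = 1 - PA - PB] while [PA P] and [P PB] vanish. *)
Theorem morse_retract : exists (dC : C -> C -> int) (f : C -> K -> int)
    (g : K -> C -> int) (h : K -> K -> int),
  [/\ forall a b, lcomp dC dC a b = 0,
      [/\ forall a x, lcomp f d a x = lcomp dC f a x,
          forall x a, lcomp d g x a = lcomp g dC x a,
          forall a a', lcomp f g a a' = (a == a')%:R &
          forall x y, lcomp g f x y - (x == y)%:R = lcomp d h x y + lcomp h d x y] &
      [/\ forall a b, dC a b != 0 -> deg (crit b) = deg (crit a) + dl,
          forall a x, f a x != 0 -> deg x = deg (crit a),
          forall x a, g x a != 0 -> deg x = deg (crit a) &
          forall x y, h x y != 0 -> deg y = deg x - dl]].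
Proof.
have [G [BG GA dG Gd Gdeg]] := morse_inverse.
pose pc a x : int := (crit a == x)%:R.
pose E := fmx pc : 'M_(#|C|, #|K|).
have ddm : dm *m dm = 0.
  by rewrite -fmx_comp; apply/matrixP=> i j; rewrite !mxE.
have PAPB : PA *m PB = 0.
  rewrite fmx_selectl; apply/matrixP=> i j; rewrite !mxE.
  by case: ifP => // /AB ->.
pose P : 'M_#|K| := gauss_proj dm (fmx G).
pose pi x y : int := (x == y)%:R - lcomp d G x y - lcomp G d x y.
have PE : P = fmx pi.
  rewrite /P /gauss_proj; apply/matrixP=> i j.
  by rewrite -!mulmxE -!fmx_comp !mxE /pi (inj_eq enum_val_inj).
have PP := gauss_PP ddm PAPB BG GA Gd.
have dP := gauss_dP (fmx G) ddm.
have PAP := gauss_PAP PAPB BG dG.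
have PPB := gauss_PPB PAPB GA Gd.
rewrite -/P -!mulmxE in PP dP PAP PPB.
clearbody P.
have pideg x y : pi x y != 0 -> deg x = deg y.
  have [-> // | xy] := eqVneq x y.
  have [dGe|/lcomp_neq0[z [/d_deg e1 /Gdeg ->]] _] := eqVneq (lcomp d G x y) 0.
    have [Gde|/lcomp_neq0[z [/Gdeg e1 /d_deg ->]] _] := eqVneq (lcomp G d x y) 0.
      by rewrite /pi (negPf xy) dGe Gde !subr0 eqxx.
    by rewrite e1 subrK.
  by rewrite e1 addrK.
pose f := lcomp pc pi; pose g := lcomp pi (fun x a => pc a x).
pose h x y := - G x y.
have fE a x : f a x = pi (crit a) x.
  rewrite /f /lcomp (bigD1 (crit a)) //= /pc eqxx mul1r big1 ?addr0 // => z.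
  by rewrite eq_sym => /negPf->; rewrite mul0r.
have gE x a : g x a = pi x (crit a).
  rewrite /g /lcomp (bigD1 (crit a)) //= /pc eqxx mulr1 big1 ?addr0 // => z.
  by rewrite eq_sym => /negPf->; rewrite mulr0.
have fm : fmx f = E *m P by rewrite fmx_comp PE.
have gm : fmx g = P *m E^T.
  rewrite fmx_comp PE; congr (_ *m _).
  by apply/matrixP=> i j; rewrite !mxE.
clearbody f g.
have ETE : E^T *m E = 1 - PA - PB.
  apply/matrixP=> i j; rewrite !mxE (reindex (fun a : C => enum_rank a)) /=; last first.
    by apply: onW_bij; apply: enum_rank_bij.
  rewrite (eq_bigr (fun a => ((crit a == enum_val i) && (i == j))%:R)); last first.
    move=> a _; rewrite !mxE !enum_rankK /pc; case: eqVneq => [-> | _] /=.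
      by rewrite (inj_eq enum_val_inj) mul1r.
    by rewrite mul0r.
  rewrite (inj_eq enum_val_inj); have [_ | _] := eqVneq i j; last first.
    by rewrite !andbF subr0 subr0 big1 // => a _; rewrite andbF.
  rewrite !andbT; have [[a <-] | nC] := critP (enum_val i).
    rewrite (bigD1 a) //= eqxx big1 ?addr0 => [|a' /negPf a'a].
      have /critP : exists b, crit b = crit a by exists a.
      by case/andP=> /negPf-> /negPf->; rewrite !subr0.
    by rewrite (inj_eq crit_inj) a'a.
  rewrite big1 => [|a _].
    move/critP: nC; rewrite negb_and !negbK => /orP[Ai | Bi].
      by rewrite Ai AB // subrr subr0.
    by have := @AB (enum_val i); rewrite Bi; case: (A _) => [->//|_]; rewrite subr0 subrr.
  by case: eqP => // e; case: nC; exists a.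
have PETEP : P *m E^T *m (E *m P) = P.
  rewrite mulmxA -(mulmxA P) ETE !mulmxBr !mulmxBl mulmx1.
  by rewrite PPB -(mulmxA P PA) PAP mulmx0 mul0mx PP !subr0.
have nAB a : (A (crit a) = false) * (B (crit a) = false).
  have /critP/andP[/negPf-> /negPf->] // : exists b, crit b = crit a by exists a.
have EPE : E *m P *m E^T = 1.
  have -> : E *m P *m E^T = fmx (fun a b => pi (crit a) (crit b)).
    rewrite -mulmxA -gm -fmx_comp; apply/fmxP => a b; rewrite /lcomp.
    rewrite (bigD1 (crit a)) //= /pc eqxx mul1r big1 ?addr0 ?gE // => z.
    by rewrite eq_sym => /negPf->; rewrite mul0r.
  apply/matrixP=> i j; rewrite !mxE /pi (inj_eq crit_inj) (inj_eq enum_val_inj).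
  (* [G] has no critical row or column, so [pi] is the identity between critical generators. *)
  have G0l a x : G (crit a) x = 0.
    by rewrite -[LHS]fmxE -BG fmx_selectl fmxE nAB.
  have G0r a x : G x (crit a) = 0.
    by rewrite -[LHS]fmxE -GA fmx_selectr fmxE nAB.
  rewrite /lcomp [X in _ - X]big1 => [|z _]; last by rewrite G0l mul0r.
  by rewrite big1 ?subr0 // => z _; rewrite G0r mulr0.
have cm : fmx (lcomp f (lcomp d g)) = E *m P *m dm *m P *m E^T.
  by rewrite !fmx_comp fm gm !mulmxA.
have hm : fmx h = - fmx G by apply/matrixP=> i j; rewrite !mxE.
exists (lcomp f (lcomp d g)), f, g, h; split; first 2 last.
- split.
  + move=> a b /lcomp_neq0[x []]; rewrite fE => /pideg ->.
    by case/lcomp_neq0=> y [/d_deg <-]; rewrite gE => /pideg.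
  + by move=> a x; rewrite fE => /pideg.
  + by move=> x a; rewrite gE => /pideg.
  + by move=> x y; rewrite oppr_eq0 => /Gdeg.
- move=> a b; rewrite -[LHS]fmxE fmx_comp cm.
  suff -> : E *m P *m dm *m P *m E^T *m (E *m P *m dm *m P *m E^T) = 0.
    by rewrite mxE.
  have -> : E *m P *m dm *m P *m E^T *m (E *m P *m dm *m P *m E^T) =
      E *m P *m dm *m (P *m E^T *m (E *m P)) *m dm *m P *m E^T.
    by rewrite !mulmxA.
  have dPd : dm *m P *m dm = 0 by rewrite dP -mulmxA ddm mulmx0.
  rewrite PETEP -(mulmxA (E *m P) dm) -(mulmxA (E *m P) (dm *m P)) dPd.
  by rewrite mulmx0 !mul0mx.
- split.
  + apply/fmxP; rewrite fmx_comp (fmx_comp _ f) cm fm.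
    rewrite -!mulmxA (mulmxA P E^T) PETEP dP !mulmxA -(mulmxA E P P) PP.
    by rewrite -!mulmxA.
  + apply/fmxP; rewrite fmx_comp (fmx_comp g) cm gm.
    rewrite !mulmxA -(mulmxA (P *m E^T)) PETEP -dP -!mulmxA (mulmxA P P) PP.
    by rewrite !mulmxA dP.
  + by move=> a b; rewrite -fmxE fmx_comp fm gm mulmxA -(mulmxA E) PP EPE mxE
      (inj_eq enum_rank_inj).
  + move=> x y; rewrite -fmxE fmx_comp fm gm PETEP PE fmxE /pi /h /lcomp.
    have cancel4 (a b c : int) : a - b - c - a = - b - c by ring.
    rewrite cancel4 -!sumrN; congr (_ + _); apply: eq_bigr => z _.
      by rewrite mulrN.
    by rewrite mulNr.
Qed.

End Morse.

(** * Homology of a deformation retract *)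

Section RetractHomology.
Variables (C K : finType) (dC : C -> C -> int) (dK : K -> K -> int).
Variables (corr : C -> K -> bool) (hdeg : K -> K -> bool).
Variables (PK : pred K) (PC : pred C).

Lemma lapp_comp (A B E : finType) (M : A -> B -> int) (N : B -> E -> int) x :
  lapp N (lapp M x) = lapp (lcomp M N) x.
Proof.
apply/ffunP=> e; rewrite !ffunE.
under eq_bigr => b _ do rewrite ffunE big_distrl /=.
rewrite exchange_big; apply: eq_bigr => a _; rewrite /lcomp big_distrr /=.
by apply: eq_bigr => b _; rewrite mulrA.
Qed.

Lemma eq_lapp (A B : finType) (M N : A -> B -> int) x :
  (forall a b, M a b = N a b) -> lapp M x = lapp N x.
Proof.
by move=> E; apply/ffunP=> b; rewrite !ffunE; apply: eq_bigr => a _; rewrite E.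
Qed.

Lemma lapp0 (A B : finType) (M : A -> B -> int) : lapp M 0 = 0.
Proof. by apply/ffunP=> b; rewrite !ffunE big1 // => a _; rewrite ffunE mul0r. Qed.

Lemma lapp_delta (A : finType) (x : {ffun A -> int}) :
  lapp (fun a b => (a == b)%:R) x = x.
Proof.
apply/ffunP=> b; rewrite ffunE (bigD1 b) //= eqxx mulr1 big1 ?addr0 // => a.
by move=> /negPf->; rewrite mulr0.
Qed.

(** Nonzero entries of [f] and [g] join generators of corresponding degree, so both maps restrict to
    the selected degrees. On a cycle the homotopy leaves a boundary; on the small complex the
    composite is the identity itself. *)
Lemma retract_homology :
  deformation_retract dC dK corr hdeg ->
  (forall a x, corr a x -> PC a = PK x) ->
  homology_iso dK PK dC PC.
Proof.
case=> f [g [h [f0 [g0 [_ [fd [dg [fg gf]]]]]]]] cP.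
exists g, f; split; [|split; [|split; [|split; [|split]]]].
- move=> x [x0 dx]; split=> [a nPa|].
    rewrite ffunE big1 // => y _; have [->|/g0 /cP E] := eqVneq (g y a) 0.
      by rewrite mulr0.
    by rewrite x0 ?mul0r // -E.
  rewrite lapp_comp (@eq_lapp _ _ _ (lcomp dK g)); last by move=> *; rewrite dg.
  by rewrite -lapp_comp dx lapp0.
- move=> x [x0 dx]; split=> [a nPa|].
    rewrite ffunE big1 // => y _; have [->|/f0 /cP E] := eqVneq (f y a) 0.
      by rewrite mulr0.
    by rewrite x0 ?mul0r // E.
  rewrite lapp_comp (@eq_lapp _ _ _ (lcomp dC f)); last by move=> *; rewrite fd.
  by rewrite -lapp_comp dx lapp0.
- move=> x _ [y ->]; exists (lapp g y); rewrite !lapp_comp.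
  by apply: eq_lapp => a b; rewrite dg.
- move=> x _ [y ->]; exists (lapp f y); rewrite !lapp_comp.
  by apply: eq_lapp => a b; rewrite fd.
- move=> x [_ dx]; exists (lapp h x); rewrite lapp_comp.
  have -> : lapp (lcomp g f) x - x =
      lapp (fun a b => lcomp dK h a b + lcomp h dK a b) x.
    rewrite -{2}[x]lapp_delta; apply/ffunP=> b; rewrite !ffunE -sumrB.
    by apply: eq_bigr => a _; rewrite -gf mulrBr.
  have -> : lapp (fun a b => lcomp dK h a b + lcomp h dK a b) x =
      lapp (lcomp dK h) x + lapp (lcomp h dK) x.
    apply/ffunP=> b; rewrite !ffunE -big_split.
    by apply: eq_bigr => a _; rewrite mulrDr.
  by rewrite -!lapp_comp dx lapp0 add0r.
- move=> y _; exists 0; rewrite lapp0 lapp_comp.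
  rewrite (@eq_lapp _ _ _ (fun a b => (a == b)%:R)) ?lapp_delta ?subrr //.
Qed.

End RetractHomology.

(** * Circles of a state as cycles of a permutation *)

Section Surgery.
Variables (n : nat) (phi : {perm hedge n}).
Implicit Types (s : {set 'I_n}) (h k : hedge n) (P Y : {set hedge n}).

Definition toggle (c : 'I_n) s : {set 'I_n} := [set i | (i \in s) (+) (i == c)].

Lemma toggleK c : involutive (toggle c).
Proof. by move=> s; apply/setP=> i; rewrite !inE -addbA addbb addbF. Qed.

Lemma toggleC a b s : toggle a (toggle b s) = toggle b (toggle a s).
Proof. by apply/setP=> i; rewrite !inE -!addbA (addbC (i == a)). Qed.

Lemma toggleU c s : c \notin s -> toggle c s = c |: s.
Proof.
move=> cs; apply/setP=> i; rewrite !inE.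
by case: eqVneq => [->|_]; rewrite ?(negPf cs) ?addbT ?addbF.
Qed.

Lemma in_toggle c s : (c \in toggle c s) = (c \notin s).
Proof. by rewrite inE eqxx addbT. Qed.

Lemma in_toggle_neq c i s : i != c -> (i \in toggle c s) = (i \in s).
Proof. by rewrite inE => /negPf->; rewrite addbF. Qed.

(** [phi] plays the role of [sigma0]: exchanging the two ends of each crossing of [s] before
    applying it gives [sigmaQ], for every state and not only for quasi-trees. *)
Definition flip s h : hedge n := if h.1 \in s then (h.1, ~~ h.2) else h.

Lemma flipK s : involutive (flip s).
Proof. by case=> i x; rewrite /flip; case E: (i \in s); rewrite /= E ?negbK. Qed.

Lemma state_perm_inj s : injective (fun h => phi (flip s h)).
Proof. by move=> h k /perm_inj/(can_inj (flipK s)). Qed.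

Definition state_perm s : {perm hedge n} := perm (@state_perm_inj s).

Lemma state_permE s h : state_perm s h = phi (flip s h).
Proof. by rewrite permE. Qed.

Lemma flip_toggle c s h :
  flip (toggle c s) h = flip s (tperm (c, false) (c, true) h).
Proof.
case: h => i x; rewrite /flip /= !inE; have [->|ic] := eqVneq i c.
  rewrite addbT; case: x; rewrite ?tpermL ?tpermR /=; by case: (c \in s).
by rewrite addbF tpermD //=; apply: contra_neq ic => -[].
Qed.

Lemma state_perm_toggle c s : state_perm (toggle c s) = (tperm (c, false) (c, true) * state_perm s)%g.
Proof. by apply/permP=> h; rewrite permM !state_permE flip_toggle. Qed.

Definition same_circle s h k := k \in porbit (state_perm s) h.

Local Notation R := same_circle.

Lemma same_circle_refl s h : R s h h. Proof. exact: porbit_id. Qed.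
Lemma same_circle_sym s h k : R s h k = R s k h. Proof. exact: porbit_sym. Qed.
Lemma same_circle_porbit s h k : R s h k -> porbit (state_perm s) h = porbit (state_perm s) k.
Proof. by rewrite /same_circle porbit_sym -eq_porbit_mem => /eqP. Qed.
Lemma same_circle_l s h k x : R s h k -> R s h x = R s k x.
Proof. by rewrite /same_circle => /same_circle_porbit->. Qed.
Lemma same_circle_r s h k x : R s h k -> R s x h = R s x k.
Proof. by rewrite !(same_circle_sym _ x) => /same_circle_l->. Qed.
Lemma same_circle_trans s h k x : R s h k -> R s k x -> R s h x.
Proof. by move=> /same_circle_l->. Qed.
Lemma same_circle_step s h : R s h (state_perm s h).
Proof. by have := mem_porbit (state_perm s) 1 h; rewrite expg1. Qed.

Definition closed s P := [forall h, (state_perm s h \in P) == (h \in P)].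

Lemma closed_step s P h : closed s P -> (state_perm s h \in P) = (h \in P).
Proof. by move/forallP/(_ h)/eqP. Qed.

Lemma closedP s P : reflect (forall h k, R s h k -> (h \in P) = (k \in P)) (closed s P).
Proof.
apply: (iffP idP) => [cP h k /porbitP[i ->]|H].
  elim: i => [|i IH]; first by rewrite perm1.
  by rewrite expgSr permM closed_step.
by apply/forallP=> h; rewrite -(H _ _ (same_circle_step s h)).
Qed.

Lemma closed_same s P h k : closed s P -> R s h k -> (h \in P) = (k \in P).
Proof. by move/closedP; apply. Qed.

(** An injection of a finite set into itself is onto, so forward invariance suffices. *)
Lemma closed_sub s P : (forall h, h \in P -> state_perm s h \in P) -> closed s P.
Proof.
move=> H; have sP : state_perm s @: P \subset P.
  by apply/subsetP=> _ /imsetP[h hP ->]; apply: H.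
have eP : state_perm s @: P = P.
  by apply/eqP; rewrite eqEcard sP card_imset ?leqnn //; apply: perm_inj.
apply/forallP=> h; apply/eqP; apply/idP/idP; last exact: H.
by rewrite -{1}eP => /imsetP[k kP /perm_inj->].
Qed.

Lemma closed_orbit s h : closed s [set k | R s h k].
Proof. by apply/closedP=> x y xy; rewrite !inE (same_circle_r _ xy). Qed.

Lemma closed_toggle c s P :
  closed s P -> ((c, false) \in P) = ((c, true) \in P) -> closed (toggle c s) P.
Proof.
move=> cP e; apply/forallP=> h; rewrite state_perm_toggle permM closed_step //.
by case: tpermP => [->|->|_ _]; rewrite ?e.
Qed.

(** A transposition raises the number of cycles by one if its points share a cycle and lowers it
    otherwise. Toggling twice restores the number, so the ends of [c] are together in exactly one of
    the two states. *)
Lemma same_circle_toggle c s : R (toggle c s) (c, false) (c, true) = ~~ R s (c, false) (c, true).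
Proof.
have := porbits_mul_tperm (state_perm s) (c, false) (c, true).
have := porbits_mul_tperm (state_perm (toggle c s)) (c, false) (c, true).
rewrite /= -!state_perm_toggle toggleK /same_circle ![(c, false) \in _]porbit_sym.
have -> : ((c, false) == (c, true) :> hedge n) = false by apply/eqP=> -[].
by case: (_ \in _); case: (_ \in _) => /=; lia.
Qed.

Definition ncyc s := #|porbits (state_perm s)|.

Lemma ncyc_toggle c s :
  (ncyc (toggle c s) + ~~ R s (c, false) (c, true) =
   ncyc s + R s (c, false) (c, true))%N.
Proof.
have := porbits_mul_tperm (state_perm s) (c, false) (c, true).
rewrite /= -!state_perm_toggle /ncyc /same_circle [(c, false) \in _]porbit_sym.
have -> : ((c, false) == (c, true) :> hedge n) = false by apply/eqP=> -[].
by case: (_ \in _) => /=; lia.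
Qed.

Definition circles_at s c h := R s (c, false) h || R s (c, true) h.

Lemma circles_atE s c h : circles_at s c h = R s (c, false) h || R s (c, true) h.
Proof. by []. Qed.

Lemma aff_stable s c h : ~~ circles_at s c h -> forall k, R (toggle c s) h k = R s h k.
Proof.
rewrite negb_or ![R _ _ h]same_circle_sym => /andP[/negPf hp /negPf hq] k.
have c1 : closed (toggle c s) [set x | R s h x].
  by apply: closed_toggle (closed_orbit _ _) _; rewrite !inE hp hq.
have sub x : R (toggle c s) h x -> R s h x.
  by move/(closed_same c1); rewrite !inE same_circle_refl => <-.
apply/idP/idP; first exact: sub.
have c2 : closed s [set x | R (toggle c s) h x].
  rewrite -{1}(toggleK c s); apply: closed_toggle; first exact: closed_orbit.
  rewrite !inE; case E1: (R _ h _); first by have := sub _ E1; rewrite hp.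
  by case E2: (R _ h _) => //; have := sub _ E2; rewrite hq.
by move/(closed_same c2); rewrite !inE same_circle_refl => <-.
Qed.

Lemma same_circle_merge c s h : ~~ R s (c, false) (c, true) ->
  R (toggle c s) (c, false) h = circles_at s c h.
Proof.
move=> nR; have R' : R (toggle c s) (c, false) (c, true) by rewrite same_circle_toggle.
apply/idP/idP.
  have cM : closed (toggle c s) [set x | circles_at s c x].
    apply: closed_toggle; last by rewrite !inE /circles_at !same_circle_refl orbT.
    by apply/closedP=> x y xy; rewrite !inE /circles_at !(same_circle_r _ xy).
  by move/(closed_same cM); rewrite !inE /circles_at same_circle_refl => <-.
have cO : closed s [set x | R (toggle c s) (c, false) x].
  rewrite -{1}(toggleK c s); apply: closed_toggle; first exact: closed_orbit.
  by rewrite !inE same_circle_refl R'.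
by case/orP=> /(closed_same cO); rewrite !inE ?same_circle_refl ?R' => <-.
Qed.

Lemma same_circle_split c s h : R s (c, false) (c, true) ->
  R s (c, false) h = circles_at (toggle c s) c h.
Proof. by move=> Rs; rewrite -{1}(toggleK c s) same_circle_merge // same_circle_toggle Rs. Qed.

Lemma aff_toggle c s h : circles_at (toggle c s) c h = circles_at s c h.
Proof.
have [Rs|nR] := boolP (R s (c, false) (c, true)).
  by rewrite -same_circle_split // /circles_at -(same_circle_l _ Rs) orbb.
by rewrite -[RHS]same_circle_merge // /circles_at -(@same_circle_l _ (c, false)) ?orbb // same_circle_toggle.
Qed.

End Surgery.

(** * The Khovanov differential squares to zero *)

Section Labels.
Variables (n : nat) (phi : {perm hedge n}).
Implicit Types (s : {set 'I_n}) (h k : hedge n) (P Y : {set hedge n}).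
Implicit Types (m e : seq (hedge n)).
Local Notation R := (same_circle phi).
Local Notation closed := (closed phi).
Local Notation circles_at := (circles_at phi).

(** [Y] and [Y'] are the unions of the circles labelled x. A split adds one x at the crossing, a
    merge adds none; merging two x gives 0, since no single circle can carry the sum 2. *)
Definition edge_coef s c Y Y' : bool :=
  [forall h, ~~ circles_at s c h ==> ((h \in Y') == (h \in Y))] &&
  (if R s (c, false) (c, true)
   then ((c, false) \in Y') + ((c, true) \in Y') == ((c, false) \in Y).+1
   else ((c, false) \in Y') == ((c, false) \in Y) + ((c, true) \in Y) :> nat)%N.

(* A monomial [m] in variables indexed by half-edges represents the labelling
   whose x-circles are those containing exactly one variable of [m]; the
   Khovanov maps are then "multiply by 1" (merge) and "multiply by the sum of
   the two ends of the crossing" (split). *)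
Definition transversal s m Y := [forall h, count (R s h) m == (h \in Y)].

Definition edge_terms s c : seq (seq (hedge n)) :=
  if R s (c, false) (c, true) then [:: [:: (c, false)]; [:: (c, true)]]
  else [:: [::]].

Lemma transversalP s m Y : reflect (forall h, count (R s h) m = (h \in Y)) (transversal s m Y).
Proof. by apply: (iffP forallP) => H h; apply/eqP; rewrite H. Qed.

Lemma count_same_circle s h k m : R s h k -> count (R s h) m = count (R s k) m.
Proof. by move=> hk; apply: eq_count => x; apply: same_circle_l. Qed.

Lemma count_merge s c m : ~~ R s (c, false) (c, true) ->
  (count (R (toggle c s) (c, false)) m =
   count (R s (c, false)) m + count (R s (c, true)) m)%N.
Proof.
move=> nR; elim: m => //= x m ->; rewrite same_circle_merge // /circles_at.
have : ~~ (R s (c, false) x && R s (c, true) x).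
  by apply: contra nR => /andP[h1]; rewrite same_circle_sym; apply: same_circle_trans.
by case: (R _ _ x); case: (R _ _ x) => // _; lia.
Qed.

Lemma count_split s c m : R s (c, false) (c, true) ->
  (count (R s (c, false)) m =
   count (R (toggle c s) (c, false)) m + count (R (toggle c s) (c, true)) m)%N.
Proof. by move=> Rs; rewrite -{1}(toggleK c s) count_merge // same_circle_toggle Rs. Qed.

Lemma count_circle_off s c h m : ~~ circles_at s c h ->
  count (R (toggle c s) h) m = count (R s h) m.
Proof. by move=> nh; apply: eq_count => x; apply: aff_stable. Qed.

Lemma transversal_ends s c m Y : closed s Y ->
  transversal s m Y =
  [&& [forall h, ~~ circles_at s c h ==> (count (R s h) m == (h \in Y))],
      count (R s (c, false)) m == ((c, false) \in Y) &
      count (R s (c, true)) m == ((c, true) \in Y)].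
Proof.
move=> cY; apply/forallP/and3P => [H | [/forallP H1 H2 H3] h].
  by split=> //; apply/forallP=> h; apply/implyP.
have [|/(implyP (H1 h)) //] := boolP (circles_at s c h).
by case/orP=> hc; rewrite -(count_same_circle _ hc) -(closed_same cY hc).
Qed.

Lemma edge_terms_unaffected s c e h : e \in edge_terms s c -> ~~ circles_at s c h -> count (R s h) e = 0%N.
Proof.
rewrite /edge_terms negb_or ![R _ _ h]same_circle_sym => eE /andP[/negPf hp /negPf hq].
move: eE; case: ifP => _; rewrite !inE; last by move=> /eqP->.
by case/orP=> /eqP-> /=; rewrite ?hp ?hq.
Qed.

(** Two variables on one circle represent x squared, which is 0. Splitting a circle labelled 1 gives
    both products; splitting one labelled x kills one product, and the other is x on both
    circles. *)
Lemma edge_coef_transversal s c m Y Y' : closed s Y -> closed (toggle c s) Y' -> transversal s m Y ->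
  (edge_coef s c Y Y' : nat) = (\sum_(e <- edge_terms s c) transversal (toggle c s) (e ++ m) Y')%N.
Proof.
move=> cY cY' /transversalP tm.
have unaff e : e \in edge_terms s c ->
    [forall h, ~~ circles_at (toggle c s) c h ==> (count (R (toggle c s) h) (e ++ m) == (h \in Y'))]
    = [forall h, ~~ circles_at s c h ==> ((h \in Y') == (h \in Y))].
  move=> eE; apply: eq_forallb => h; rewrite aff_toggle; apply: implyb_id2l => nh.
  rewrite count_circle_off // count_cat (edge_terms_unaffected eE nh) tm eq_sym.
  by case: (_ \in _); case: (_ \in _).
have tE e : e \in edge_terms s c -> transversal (toggle c s) (e ++ m) Y' =
    [&& [forall h, ~~ circles_at s c h ==> ((h \in Y') == (h \in Y))],
      count (R (toggle c s) (c, false)) (e ++ m) == ((c, false) \in Y') &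
      count (R (toggle c s) (c, true)) (e ++ m) == ((c, true) \in Y')].
  by move=> eE; rewrite (transversal_ends c) // unaff.
rewrite big_seq (eq_bigr _ (fun e eE => congr1 nat_of_bool (tE e eE))) -big_seq.
rewrite /edge_coef; case: [forall h, _] => /=; last by rewrite big1.
rewrite /edge_terms; have [Rs|nR] := boolP (R s (c, false) (c, true)).
  rewrite !big_cons big_nil /= !same_circle_refl.
  have nR' : R (toggle c s) (c, false) (c, true) = false by rewrite same_circle_toggle Rs.
  rewrite [R _ (c, true) (c, false)]same_circle_sym nR' !add0n addn0.
  have := tm (c, false); rewrite (count_split _ Rs).
  move: (count _ m) (count _ m) => x y.
  case: (_ \in Y); case: (_ \in Y'); case: (_ \in Y');
    case: x => [|[|x]]; case: y => [|[|y]] => //=; lia.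
rewrite big_cons big_nil /= addn0 -[count _ _ in X in _ = (_ && X) :> nat](@count_same_circle _ (c, false)) ?same_circle_toggle //.
rewrite count_merge // !tm -(closed_same cY' (_ : R (toggle c s) (c, false) (c, true))) ?same_circle_toggle //.
by rewrite andbb eq_sym.
Qed.

(** No Khovanov map turns x into 1, so an x on the base circle persists and the reduced generators
    span a subcomplex. *)
Lemma edge_coef_sub s c Y Y' h : closed s Y -> closed (toggle c s) Y' -> edge_coef s c Y Y' ->
  h \in Y -> h \in Y'.
Proof.
move=> cY cY' /andP[/forallP H1 H2] hY.
have [|nh] := boolP (circles_at s c h); last by have := H1 h; rewrite nh hY => /eqP.
have [Rs|nR] := boolP (R s (c, false) (c, true)); rewrite ?Rs ?(negPf nR) in H2.
  rewrite -aff_toggle => ah; have pY : (c, false) \in Y.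
    by move: ah; rewrite -same_circle_split // => /(closed_same cY)->.
  move: H2 ah; rewrite pY; case E1: (_ \in Y'); case E2: (_ \in Y') => // _.
  by case/orP=> /(closed_same cY') <-.
move=> ah; have := ah; rewrite -same_circle_merge // => /(closed_same cY') <-.
move: H2; case/orP: ah => /(closed_same cY) ->; rewrite hY; case: (_ \in Y') => //.
by rewrite addn1.
Qed.

Lemma transversal_le1 s m Y h : transversal s m Y -> (count (R s h) m <= 1)%N.
Proof. by move=> /transversalP->; apply: leq_b1. Qed.

(** A vanishing monomial stays zero: a merge adds the counts, and a split brings in one more
    variable and so distributes at least three over two circles. *)
Lemma transversal_obstr s c m e Y h : e \in edge_terms s c -> (1 < count (R s h) m)%N ->
  transversal (toggle c s) (e ++ m) Y = false.
Proof.
move=> eE big; apply/negP=> T; have leT k := transversal_le1 k T.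
have [ah|nh] := boolP (circles_at s c h); last first.
  by have := leT h; rewrite count_circle_off // count_cat; lia.
have [Rs|nR] := boolP (R s (c, false) (c, true)); last first.
  have := leT (c, false); rewrite count_merge // count_cat.
  case/orP: ah => /count_same_circle E; rewrite !count_cat !E; lia.
have hc : R s (c, false) h by case/orP: ah => // /(same_circle_trans Rs).
move: big; rewrite -(count_same_circle _ hc) (count_split _ Rs).
have := leT (c, true); have := leT (c, false).
move: eE; rewrite /edge_terms Rs !inE => /orP[] /eqP-> /=; rewrite !same_circle_refl; lia.
Qed.

Lemma transversal_closed s m Y : transversal s m Y -> closed s Y.
Proof.
by move=> /transversalP T; apply/closedP=> h k hk; move: (T h) (T k);
  rewrite (count_same_circle _ hk) => -> ; case: (_ \in _); case: (_ \in _).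
Qed.

Lemma transversal_uniq s m Y Y' : transversal s m Y -> transversal s m Y' -> Y = Y'.
Proof.
move=> /transversalP T /transversalP T'; apply/setP=> h; move: (T h); rewrite T'.
by case: (_ \in _); case: (_ \in _).
Qed.

Lemma transversal_of_le1 s m : (forall h, count (R s h) m <= 1)%N ->
  transversal s m [set h | 0 < count (R s h) m]%N.
Proof. by move=> le1; apply/transversalP=> h; rewrite inE; have := le1 h; case: count => [|[]]. Qed.

Lemma transversal_ex s Y : closed s Y -> exists m, transversal s m Y.
Proof.
move=> cY; pose rt h := odflt h [pick x in porbit (state_perm phi s) h].
have rtR h : R s h (rt h).
  by rewrite /rt; case: pickP => // _; apply: same_circle_refl.
have rt_eq h k : R s h k -> rt h = rt k.
  rewrite /rt => /same_circle_porbit<-; case: pickP => // /(_ h).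
  by rewrite porbit_id.
exists [seq h <- enum Y | rt h == h]; apply/transversalP=> h; rewrite count_filter.
have [hY|nY] := boolP (h \in Y); last first.
  apply/eqP; rewrite -leqn0 leqNgt -has_count; apply/hasPn=> x.
  rewrite mem_enum /= => xY; apply/negP=> /andP[/(closed_same cY) E _].
  by rewrite E xY in nY.
rewrite (@eq_in_count _ _ (pred1 (rt h))) => [|x _ /=].
  by rewrite count_uniq_mem ?enum_uniq // mem_enum -(closed_same cY (rtR h)) hY.
apply/andP/eqP => [[/rt_eq-> /eqP->] // | ->].
by split=> //; rewrite -(rt_eq _ _ (rtR h)).
Qed.

Lemma transversal_swap s e e' m Y : transversal s (e ++ e' ++ m) Y = transversal s (e' ++ e ++ m) Y.
Proof. by apply: eq_forallb => h; rewrite !count_cat addnCA. Qed.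

Lemma transversal_cons s x y m Y : R s x y -> transversal s (x :: m) Y = transversal s (y :: m) Y.
Proof. by move=> xy; apply: eq_forallb => h /=; rewrite (same_circle_r _ xy). Qed.

(** Counting circles at the four corners of the square shows that both paths have equally many
    splits. The products agree formally unless one path splits at [a] only and the other at [b]
    only; then the ends of [a] and [b] lie on the same circles of the final state. *)
Lemma edge_terms_square s a b m Y :
  (\sum_(e <- edge_terms s a) \sum_(e' <- edge_terms (toggle a s) b)
     transversal (toggle b (toggle a s)) (e' ++ e ++ m) Y =
   \sum_(e <- edge_terms s b) \sum_(e' <- edge_terms (toggle b s) a)
     transversal (toggle b (toggle a s)) (e' ++ e ++ m) Y)%N.
Proof.
set t := toggle b (toggle a s).
have tE : t = toggle a (toggle b s) by rewrite /t toggleC.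
pose Ra s := R s (a, false) (a, true); pose Rb s := R s (b, false) (b, true).
have ta : toggle a t = toggle b s by rewrite tE toggleK.
have tb : toggle b t = toggle a s by rewrite /t toggleK.
have Ra1 : Ra (toggle a s) = ~~ Ra s by apply: same_circle_toggle.
have Rb1 : Rb (toggle b s) = ~~ Rb s by apply: same_circle_toggle.
have Rat : Ra t = ~~ Ra (toggle b s) by rewrite tE; apply: same_circle_toggle.
have Rbt : Rb t = ~~ Rb (toggle a s) by apply: same_circle_toggle.
have cnt : (Ra s + Rb (toggle a s) = Rb s + Ra (toggle b s))%N.
  have := ncyc_toggle phi a s; have := ncyc_toggle phi b (toggle a s).
  have := ncyc_toggle phi b s; have := ncyc_toggle phi a (toggle b s).
  rewrite -/(Ra _) -/(Rb _) -/(Ra _) -/(Rb _) -/t -tE.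
  by case: (Ra s); case: (Rb s); case: (Ra _); case: (Rb _) => /=; lia.
rewrite /edge_terms -/(Ra _) -/(Rb _) -/(Ra _) -/(Rb _).
case: (boolP (Ra s)) cnt Ra1 => Ras; case: (boolP (Rb (toggle a s))) Rbt => Rbas Rbt;
  case: (boolP (Rb s)) Rb1 => Rbs Rb1; case: (boolP (Ra (toggle b s))) Rat => Rabs Rat //=;
  move=> _ Ra1; rewrite !big_cons !big_nil ?addn0 ?cat0s //=.
- by rewrite addnACA; congr (_ + _ + (_ + _))%N; rewrite (transversal_swap _ [:: _] [:: _]).
(* Split first, merge second on both paths: all four ends lie on one circle of [t]. *)
- have ab : R t (a, false) (b, false).
    apply/negPn/negP=> nab; move: Rb1; rewrite /Rb -ta aff_stable ?[R t _ _]Rbt //.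
    by rewrite /circles_at -(same_circle_l _ (Rat : R t (a, false) (a, true))) orbb.
  have aa : R t (a, false) (a, true) by [].
  have bb : R t (b, false) (b, true) by [].
  rewrite -(transversal_cons _ _ aa) -(transversal_cons _ _ bb).
  by rewrite (transversal_cons _ _ ab).
(* Merge first, split second on both paths: the ends of [a] lie one on each of the two circles of
   [t] at [b]. *)
- have na : ~~ R t (a, false) (a, true) by rewrite -/(Ra t) Rat.
  have nb : ~~ R t (b, false) (b, true) by rewrite -/(Rb t) Rbt.
  have af : circles_at t b (a, false).
    by apply/negPn/negP=> /aff_stable E; move: na; rewrite -E tb -/(Ra _) Ra1.
  have at_ : circles_at t b (a, true).
    by apply/negPn/negP=> /aff_stable E; move: na; rewrite same_circle_sym -E tb same_circle_sym -/(Ra _) Ra1.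
  case/orP: af => pa; case/orP: at_ => qa.
  + by case/negP: na; rewrite -(same_circle_l _ pa).
  + by rewrite (transversal_cons _ _ pa) (transversal_cons _ _ qa).
  + by rewrite (transversal_cons _ _ pa) (transversal_cons _ _ qa) addnC.
  + by case/negP: na; rewrite -(same_circle_l _ pa).
Qed.
End Labels.

Section Cube.
Variables (n : nat) (phi : {perm hedge n}) (beta : hedge n).
Variables (K : finType) (st : K -> {set 'I_n}) (lab : K -> {set hedge n}).
Variable d : K -> K -> int.
Local Notation R := (same_circle phi).
Local Notation closed := (closed phi).

Definition ksign (s : {set 'I_n}) (c : 'I_n) : int :=
  (-1) ^+ #|[set i in s | (i < c)%N]|.

(* [lab y] is the union of the circles labelled x; the circle of the base
   half-edge [beta] always is. *)
Record cube_model : Prop := CubeModel {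
  cube_closed : forall y, closed (st y) (lab y);
  cube_base : forall y, beta \in lab y;
  cube_inj : forall y z, st y = st z -> lab y = lab z -> y = z;
  cube_surj : forall s Y, closed s Y -> beta \in Y ->
    exists y, st y = s /\ lab y = Y;
  cube_edge : forall x y c, c \notin st x -> st y = toggle c (st x) ->
    d x y = ksign (st x) c * (edge_coef phi (st x) c (lab x) (lab y))%:R;
  cube_non_edge : forall x y, d x y != 0 ->
    exists c, c \notin st x /\ st y = toggle c (st x) }.

Hypothesis M : cube_model.

(** After the first step each monomial either vanishes for good or labels exactly one generator, so
    summing over intermediate generators amounts to summing over pairs of terms. *)
Lemma cube_path_sum (x z : K) (a b : 'I_n) (m : seq (hedge n)) :
  st z = toggle b (toggle a (st x)) -> transversal phi (st x) m (lab x) ->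
  (\sum_(y | st y == toggle a (st x))
     edge_coef phi (st x) a (lab x) (lab y) * edge_coef phi (st y) b (lab y) (lab z) =
   \sum_(e <- edge_terms phi (st x) a) \sum_(e' <- edge_terms phi (toggle a (st x)) b)
     transversal phi (st z) (e' ++ e ++ m) (lab z))%N.
Proof.
move=> zE tm.
pose T e y := transversal phi (toggle a (st x)) (e ++ m) (lab y).
have cz := cube_closed M z; rewrite zE in cz.
transitivity (\sum_(e <- edge_terms phi (st x) a) \sum_(y | st y == toggle a (st x))
   T e y * edge_coef phi (st y) b (lab y) (lab z))%N.
  rewrite exchange_big; apply: eq_bigr => y /eqP yE; rewrite -big_distrl /=.
  congr (_ * _)%N; apply: edge_coef_transversal => //; first exact: cube_closed.
  by rewrite -yE; apply: cube_closed.
rewrite !big_seq; apply: eq_bigr => e eE.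
have [/existsP[h big]|/existsPn le1] :=
    boolP [exists h, 1 < count (R (toggle a (st x)) h) (e ++ m)]%N.
  rewrite big1 => [|y yE].
    by rewrite big_seq big1 // => e' e'E; rewrite zE (transversal_obstr _ e'E big).
  apply/eqP; rewrite muln_eq0; apply/orP; left; rewrite eqb0.
  by apply/negP=> Ty; have := transversal_le1 h Ty; rewrite leqNgt big.
have {}le1 h : (count (R (toggle a (st x)) h) (e ++ m) <= 1)%N.
  by have := le1 h; rewrite -leqNgt.
have tY := transversal_of_le1 le1; set Y := [set h | _] in tY.
have cY := transversal_closed tY.
have bY : beta \in Y.
  have cx := cube_closed M x.
  apply: (edge_coef_sub cx cY _ (cube_base M x)).
  have := edge_coef_transversal cx cY tm; rewrite (big_rem e) //= tY.
  by case: edge_coef.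
have [y0 [sy0 ly0]] := cube_surj M cY bY.
rewrite (bigD1 y0) ?sy0 //= big1 => [|y /andP[/eqP sy yy0]]; last first.
  apply/eqP; rewrite muln_eq0; apply/orP; left; rewrite eqb0; apply/negP=> Ty.
  case/eqP: yy0; apply: (cube_inj M); first by rewrite sy sy0.
  by rewrite ly0; apply: transversal_uniq Ty tY.
rewrite addn0 /T ly0 tY mul1n zE; apply: edge_coef_transversal => //.
Qed.

(** Adding [a] changes the number of elements below [b] by one, while adding [b] leaves the number
    below [a] unchanged. *)
Lemma ksign_square (s : {set 'I_n}) (a b : 'I_n) : (a < b)%N -> a \notin s -> b \notin s ->
  ksign s a * ksign (toggle a s) b = - (ksign s b * ksign (toggle b s) a).
Proof.
move=> ab na nb; rewrite /ksign.
have -> : [set i in toggle b s | (i < a)%N] = [set i in s | (i < a)%N].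
  apply/setP=> i; rewrite !inE; have [->|_] := eqVneq i b; rewrite ?addbF //.
  by rewrite (ltnNge b) (ltnW ab) !andbF.
have -> : [set i in toggle a s | (i < b)%N] = a |: [set i in s | (i < b)%N].
  apply/setP=> i; rewrite !inE; have [->|_] := eqVneq i a; rewrite ?addbF //.
  by rewrite ab (negPf na).
by rewrite cardsU1 inE (negPf na) /= exprS mulN1r mulrN mulrC.
Qed.

Theorem cube_dd x z : lcomp d d x z = 0.
Proof.
have [//|/lcomp_neq0[y0 []]] := eqVneq (lcomp d d x z) 0.
case/(cube_non_edge M)=> a [na y0E] /(cube_non_edge M)[b [nb zE]].
rewrite y0E in nb zE.
have ab : a != b by apply: contra nb => /eqP<-; rewrite in_toggle.
rewrite in_toggle_neq 1?eq_sym // in nb.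
wlog lab' : a b na nb ab zE {y0 y0E} / (a < b)%N.
  move=> W; have [lt|gt|/val_inj E] := ltngtP a b; first exact: (W a b).
    by apply: (W b a) => //; rewrite 1?eq_sym // toggleC.
  by rewrite E eqxx in ab.
have [m tm] := transversal_ex (cube_closed M x).
have nb' : b \notin toggle a (st x) by rewrite in_toggle_neq 1?eq_sym.
have na' : a \notin toggle b (st x) by rewrite in_toggle_neq.
have tt : toggle a (st x) != toggle b (st x).
  by apply: contra nb' => /eqP->; rewrite in_toggle.
pose g c c' : int := ksign (st x) c * ksign (toggle c (st x)) c' *
  (\sum_(y | st y == toggle c (st x))
     edge_coef phi (st x) c (lab x) (lab y) * edge_coef phi (st y) c' (lab y) (lab z))%N%:R.
have part c c' : c \notin st x -> c' \notin toggle c (st x) ->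
    st z = toggle c' (toggle c (st x)) ->
    \sum_(y | st y == toggle c (st x)) d x y * d y z = g c c'.
  move=> nc nc' zE'; rewrite /g natr_sum mulr_sumr; apply: eq_bigr => y /eqP yE.
  rewrite (cube_edge M nc yE) (@cube_edge M y z c') ?yE // natrM mulrACA.
  by congr (_ * _).
have zE2 : st z = toggle a (toggle b (st x)) by rewrite zE toggleC.
rewrite /lcomp (bigID (fun y => st y == toggle a (st x))) /= (part a b) //.
rewrite (bigID (fun y => st y == toggle b (st x))) /= [X in _ + (_ + X)]big1; last first.
  move=> y /andP[ya yb]; apply/eqP/negPn; rewrite mulf_eq0 negb_or.
  apply/negP=> /andP[/(cube_non_edge M)[c [nc yc]]].
  case/(cube_non_edge M)=> c' [nc' zc']; rewrite yc zE in zc' ya yb.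
  have : c \in toggle b (toggle a (st x)).
    rewrite zc' in_toggle_neq ?in_toggle //; apply: contra nc' => /eqP<-.
    by rewrite yc in_toggle.
  rewrite !inE (negPf nc) /=; case: eqVneq => [ca|_]; last first.
    by move=> /eqP cb; rewrite cb eqxx in yb.
  by rewrite ca eqxx in ya.
rewrite addr0 (eq_bigl (fun y => st y == toggle b (st x))) => [|y]; last first.
  by case: (eqVneq (st y) (toggle b (st x))) => [->|]; rewrite ?andbF // eq_sym tt.
rewrite (part b a) // /g (cube_path_sum zE tm) (cube_path_sum zE2 tm) zE.
by rewrite edge_terms_square ksign_square // mulNr addNr.
Qed.
End Cube.

(** * Quasi-trees and intervals of states *)

Section Intervals.
Variables (n : nat) (phi : {perm hedge n}) (beta : hedge n).
Implicit Types (a b c : 'I_n) (s Q L : {set 'I_n}) (h : hedge n) (P Y : {set hedge n}).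
Local Notation R := (same_circle phi).
Local Notation closed := (closed phi).
Local Notation circles_at := (circles_at phi).

Definition onecyc Q := [forall h, forall k, R Q h k].

Lemma onecycP Q : reflect (forall h k, R Q h k) (onecyc Q).
Proof. by apply: (iffP forallP) => [H h k|H h]; [exact: (forallP (H h)) | apply/forallP]. Qed.

Lemma closed_onecyc Q P h k : onecyc Q -> closed Q P -> (h \in P) = (k \in P).
Proof. by move=> /onecycP oQ cP; apply: closed_same cP (oQ h k). Qed.

Lemma closed_change s s' P : closed s P ->
  (forall i, (i \in s) != (i \in s') -> ((i, false) \in P) = ((i, true) \in P)) ->
  closed s' P.
Proof.
move=> cP H; apply/forallP=> -[i x]; apply/eqP.
have E : (state_perm phi s' (i, x) \in P) =
   ((if (i \in s) == (i \in s') then (i, x) else (i, ~~ x)) \in P).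
  rewrite -(closed_step (if _ then _ else _) cP) !state_permE /flip.
  by case E1: (i \in s); case E2: (i \in s'); rewrite /= ?E1 ?E2 ?negbK.
rewrite E; case: ifP => // /negbT /H e.
by case: {E} x; rewrite /= e.
Qed.

(** Toggling [a] cuts the single circle of [Q] in two; this is the part away from [beta], and [rep]
    is the end of [a] on it. For distinct edges [linked] means that the chords interleave; by
    [self_linked] it also holds of an edge with itself. *)
Definition side Q a : {set hedge n} := [set h | ~~ R (toggle a Q) beta h].
Definition rep Q a : hedge n :=
  if R (toggle a Q) beta (a, false) then (a, true) else (a, false).
Definition linked Q a b : bool := ((b, false) \in side Q a) != ((b, true) \in side Q a).

Lemma closed_side Q a : closed (toggle a Q) (side Q a).
Proof. by apply/closedP=> h k hk; rewrite !inE (same_circle_r _ hk). Qed.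

Lemma beta_side Q a : beta \notin side Q a.
Proof. by rewrite inE same_circle_refl. Qed.

Lemma circles_at_onecyc Q a h : onecyc Q -> circles_at (toggle a Q) a h.
Proof. by move/onecycP=> oQ; rewrite -same_circle_split. Qed.

Lemma onecyc_split Q a : onecyc Q -> ~~ R (toggle a Q) (a, false) (a, true).
Proof. by move/onecycP=> oQ; rewrite same_circle_toggle negbK. Qed.

Lemma ends_side Q a x : onecyc Q -> ((a, x) \in side Q a) = ((a, x) == rep Q a).
Proof.
move=> oQ; have := circles_at_onecyc a beta oQ; have nR := onecyc_split a oQ.
rewrite /rep inE circles_atE.
have [b0|nb0] := boolP (R (toggle a Q) beta (a, false)).
  have /negPf nb1 : ~~ R (toggle a Q) beta (a, true) by rewrite (same_circle_l _ b0).
  by move=> _; case: x; rewrite ?nb1 ?b0 ?eqxx //; apply/esym/eqP=> -[].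
rewrite (same_circle_sym _ _ _ beta) (negPf nb0) /= (same_circle_sym _ _ _ beta) => b1.
by case: x; rewrite ?b1 ?nb0 ?eqxx //; apply/esym/eqP=> -[].
Qed.

Lemma repE Q a : rep Q a = (a, (rep Q a).2).
Proof. by rewrite /rep; case: ifP. Qed.

Definition corep Q a : hedge n := (a, ~~ (rep Q a).2).

Lemma rep_side Q a : onecyc Q -> rep Q a \in side Q a.
Proof. by move=> oQ; rewrite {1}repE ends_side // -repE. Qed.

Lemma corep_side Q a : onecyc Q -> corep Q a \notin side Q a.
Proof.
move=> oQ; rewrite ends_side //; apply/eqP=> /(congr1 snd) /=.
by case: (rep Q a).2.
Qed.

Lemma circles_at_rep s Q a h : circles_at s a h = R s (rep Q a) h || R s (corep Q a) h.
Proof. by rewrite /corep /rep circles_atE; case: ifP => //= _; rewrite orbC. Qed.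

Lemma self_linked Q a : onecyc Q -> linked Q a a.
Proof.
by move=> oQ; rewrite /linked !ends_side // repE !xpair_eqE eqxx; case: (rep Q a).2.
Qed.

Lemma sideE Q a h : onecyc Q -> (h \in side Q a) = R (toggle a Q) (rep Q a) h.
Proof.
move=> oQ; have := circles_at_onecyc a h oQ; rewrite (circles_at_rep _ Q); have cP := closed_side Q a.
case: (boolP (R _ (rep Q a) h)) => [/(closed_same cP) <- _|_ /(closed_same cP) <-].
  exact: rep_side.
by apply: negbTE; apply: corep_side.
Qed.

Lemma side_same_circle Q a h k : onecyc Q ->
  R (toggle a Q) h k = ((h \in side Q a) == (k \in side Q a)).
Proof.
move=> oQ; have [hP|] := boolP (h \in side Q a).
  by rewrite eq_sym eqb_id sideE // -(same_circle_l k (_ : R _ (rep Q a) h)) // -sideE.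
rewrite inE negbK => hb; rewrite -(same_circle_l k hb) inE.
by case: (R _ beta k).
Qed.

Lemma linkedE Q a b : onecyc Q -> linked Q a b = ~~ R (toggle a Q) (b, false) (b, true).
Proof. by move=> oQ; rewrite side_same_circle. Qed.

(** Toggling [b] rejoins the two parts exactly when it has an end in each. The criterion is
    symmetric in [a] and [b], and it produces new quasi-trees from linked pairs. *)
Lemma linked_onecyc Q a b : onecyc Q -> linked Q a b = onecyc (toggle b (toggle a Q)).
Proof.
move=> oQ; rewrite linkedE // -same_circle_toggle; apply/idP/onecycP => [R1 h k|]; last exact.
have nR : ~~ R (toggle a Q) (b, false) (b, true) by rewrite -same_circle_toggle.
suff all h' : R (toggle b (toggle a Q)) (b, false) h' by rewrite -(same_circle_l k (all h)).
rewrite same_circle_merge // circles_atE !side_same_circle //; rewrite side_same_circle // in nR.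
by case: (_ \in _) nR; case: (_ \in _) => //; case: (_ \in _).
Qed.

Lemma linked_sym Q a b : onecyc Q -> linked Q a b = linked Q b a.
Proof. by move=> oQ; rewrite !linked_onecyc // toggleC. Qed.

Definition unlinked_below Q a := [forall b : 'I_n, (b < a)%N ==> ~~ linked Q a b].

Lemma unlinked_below_pair Q a b : onecyc Q -> unlinked_below Q a -> unlinked_below Q b -> a != b ->
  ~~ linked Q a b.
Proof.
move=> oQ /forallP la /forallP lb ab.
have [lt|gt|/val_inj E] := ltngtP a b; last by rewrite E eqxx in ab.
  by rewrite linked_sym //; apply: (implyP (lb a)).
exact: (implyP (la b)).
Qed.

(** Subsets read as binary numbers: comparison is decided by the highest edge at which they
    differ. *)
Definition binary_weight (A : {set 'I_n}) : nat := \sum_(i in A) 2 ^ i.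

Lemma binary_weight_lt (A B : {set 'I_n}) (k : 'I_n) :
  (forall i : 'I_n, (k < i)%N -> (i \in A) = (i \in B)) -> k \notin A -> k \in B ->
  (binary_weight A < binary_weight B)%N.
Proof.
move=> E kA kB; rewrite /binary_weight.
have split3 (X : {set 'I_n}) : (\sum_(i in X) 2 ^ i = \sum_(i in X | (k < i)%N) 2 ^ i +
    ((k \in X) * 2 ^ k + \sum_(i in X | (i < k)%N) 2 ^ i))%N.
  rewrite (bigID (fun i : 'I_n => k < i)%N) /=; congr (_ + _)%N.
  rewrite big_mkcond (bigD1 k) //= ltnn andbT; congr (_ + _)%N.
    by case: (k \in X); rewrite ?mul1n.
  rewrite -big_mkcondr /=; apply: eq_bigl => i.
  by rewrite -leqNgt (ltn_neqAle i) -val_eqE andbCA.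
rewrite !split3 (negPf kA) kB mul0n mul1n add0n.
rewrite (eq_bigl (fun i => (i \in B) && (k < i)%N)) => [|i]; last first.
  by case: (boolP (k < i)%N) => [/E->|]; rewrite ?andbF.
rewrite ltn_add2l ltn_addr //.
have lt2 : (\sum_(i < n | i < k) 2 ^ i < 2 ^ k)%N.
  rewrite -(big_ord_widen _ (fun i => 2 ^ i)%N (ltnW (ltn_ord k))).
  elim: (k : nat) => [|m IH]; first by rewrite big_ord0.
  by rewrite big_ord_recr expnS mul2n -addnn -addSn leq_add2r.
apply: leq_ltn_trans lt2; rewrite big_mkcondl; apply: leq_sum => i _.
by case: ifP.
Qed.

Lemma top_diff (A B : {set 'I_n}) : A != B -> exists k : 'I_n,
  (k \in A) != (k \in B) /\ forall i : 'I_n, (k < i)%N -> (i \in A) = (i \in B).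
Proof.
move=> AB; have [k0 k0P] : exists k, (k \in A) != (k \in B).
  by apply/existsP; apply: contraR AB => /existsPn H; apply/eqP/setP=> i;
    apply/eqP; move: (H i); rewrite negbK.
case: (@arg_maxnP _ k0 (fun k => (k \in A) != (k \in B)) (@nat_of_ord n) k0P) => k kP max.
exists k; split=> // i ki; apply/eqP/negPn/negP=> /max /=.
by rewrite leqNgt ki.
Qed.

(** If [k] were live, every edge at which [toggle k Q] and [Q'] differ would lie below [k] and have
    both ends on one side, making [side Q k] a union of circles of [Q']. But it separates the ends
    of [k], and [Q'] has a single circle. *)
Lemma unlinked_below_top Q Q' (k : 'I_n) : onecyc Q -> onecyc Q' ->
  (forall i : 'I_n, (k < i)%N -> (i \in Q) = (i \in Q')) -> (k \in Q) != (k \in Q') ->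
  ~~ unlinked_below Q k.
Proof.
move=> oQ oQ' E kQ; apply/negP=> /forallP lk.
have cP : closed Q' (side Q k).
  apply: (closed_change (closed_side Q k)) => i.
  have [-> | ik] := eqVneq i k; first by rewrite in_toggle; case: (_ \in Q) kQ; case: (_ \in Q').
  rewrite in_toggle_neq // => iQ; apply/eqP; have := lk i; rewrite negbK => /implyP; apply.
  have [//|lt|/val_inj ei] := ltngtP i k; last by rewrite ei eqxx in ik.
  by rewrite E ?eqxx in iQ.
by have := self_linked k oQ; rewrite /linked (closed_onecyc _ (k, true) oQ' cP) eqxx.
Qed.

Definition interval s Q := [forall k, ((k \in s) == (k \in Q)) || unlinked_below Q k].

Lemma intervalP s Q k : interval s Q -> ~~ unlinked_below Q k -> (k \in s) = (k \in Q).
Proof. by move=> /forallP/(_ k)/orP[/eqP|->]. Qed.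

(** Take a quasi-tree whose agreement set with [s] has the greatest binary weight. A disagreement at
    a non-live [k] could be toggled together with a linked [b] below it: the agreement set would
    gain [k] and otherwise change only at [b], so its weight would grow. *)
Lemma interval_ex s : (exists Q, onecyc Q) -> exists Q, onecyc Q && interval s Q.
Proof.
case=> Q0 oQ0.
pose agr Q := [set i | (i \in s) == (i \in Q)].
case: (@arg_maxnP _ Q0 onecyc (fun Q => binary_weight (agr Q)) oQ0) => Q oQ max.
exists Q; rewrite oQ; apply/forallP=> k; apply/negPn; rewrite negb_or.
apply/negP=> /andP[kQ /forallPn[b]]; rewrite negb_imply negbK => /andP[bk].
rewrite linked_onecyc // => /max /=; rewrite leqNgt => /negP; apply.
apply: (@binary_weight_lt _ _ k) => [i ki||].
- have ib : (i == b) = false by apply/negbTE; rewrite -val_eqE neq_ltn (ltn_trans bk ki) orbT.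
  have ik : (i == k) = false by apply/negbTE; rewrite -val_eqE neq_ltn ki orbT.
  by rewrite !inE ib ik !addbF.
- by rewrite inE.
- have kb : (k == b) = false by apply/negbTE; rewrite -val_eqE neq_ltn bk orbT.
  rewrite !inE eqxx kb.
  by move: kQ; case: (_ \in s); case: (_ \in Q).
Qed.

Lemma interval_uniq s Q Q' : onecyc Q -> onecyc Q' -> interval s Q -> interval s Q' ->
  Q = Q'.
Proof.
move=> oQ oQ' iQ iQ'; apply/eqP/negPn/negP=> /top_diff[k [kQ E]].
move: (kQ); rewrite -(intervalP iQ (unlinked_below_top oQ oQ' E kQ)).
rewrite -(intervalP iQ') ?eqxx //; apply: unlinked_below_top oQ' oQ _ _; last by rewrite eq_sym.
by move=> i /E.
Qed.

Lemma interval_lt s c Q Q' : onecyc Q -> onecyc Q' -> c \notin s ->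
  interval s Q -> interval (toggle c s) Q' -> Q != Q' -> (binary_weight Q < binary_weight Q')%N.
Proof.
move=> oQ oQ' cs iQ iQ' /top_diff[k [kQ E]].
have Q'E : (k \in toggle c s) = (k \in Q').
  apply: intervalP iQ' _; apply: unlinked_below_top oQ' oQ _ _; last by rewrite eq_sym.
  by move=> i /E.
have QE := intervalP iQ (unlinked_below_top oQ oQ' E kQ).
have kc : k = c.
  by apply/eqP; apply: contraR kQ => kc; rewrite -QE -Q'E in_toggle_neq.
by apply: (binary_weight_lt E); rewrite -?QE -?Q'E kc ?in_toggle.
Qed.

End Intervals.

(** * Nested regions cut off by live edges *)

Section Regions.
Variables (n : nat) (phi : {perm hedge n}) (beta : hedge n).
Variables (Q : {set 'I_n}).
Implicit Types (a b c : 'I_n) (s L : {set 'I_n}) (h : hedge n) (P Y : {set hedge n}).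
Local Notation R := (same_circle phi).
Local Notation closed := (closed phi).
Local Notation circles_at := (circles_at phi).
Local Notation side := (side phi beta Q).
Local Notation rep := (rep phi beta Q).
Local Notation corep := (corep phi beta Q).
Local Notation live := (unlinked_below phi beta Q).
Hypothesis oQ : onecyc phi Q.

Lemma unlinked_end a b x : ~~ linked phi beta Q a b ->
  ((b, x) \in side a) = (rep b \in side a).
Proof. by rewrite repE negbK => /eqP e; case: x; case: (rep b).2; rewrite ?e. Qed.

Lemma state_perm_toggle_other a h : h.1 != a -> state_perm phi (toggle a Q) h = state_perm phi Q h.
Proof. by move=> ha; rewrite !state_permE /flip in_toggle_neq. Qed.

Lemma side_step a h : h.1 != a -> (state_perm phi Q h \in side a) = (h \in side a).
Proof. by move=> ha; rewrite -(state_perm_toggle_other ha) (closed_step _ (closed_side _ _ _ _)). Qed.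

(* If the ends of each of [a], [b] lay on the non-base side of the other, the
   half-edges outside both sides would form an invariant set containing [beta]. *)
Lemma laminar a b : live a -> live b -> a != b ->
  rep a \in side b -> rep b \notin side a.
Proof.
move=> la lb ab ra; apply/negP=> rb.
have uab := unlinked_below_pair oQ la lb ab.
have uba : ~~ linked phi beta Q b a by rewrite linked_sym.
pose N := ~: (side a :|: side b).
have cN : closed Q N.
  apply: closed_sub => -[i x]; rewrite !in_setC !in_setU => /norP[ha hb].
  have ia : i != a by apply: contraNneq hb => ->; rewrite unlinked_end.
  have ib : i != b by apply: contraNneq ha => ->; rewrite unlinked_end.
  by rewrite !side_step // negb_or ha.
have := closed_onecyc beta (rep a) oQ cN; rewrite !in_setC !in_setU ra orbT.
by rewrite !(negPf (beta_side _ _ _ _)).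
Qed.

(** [side a :\: side b] is invariant under the single cycle of [Q] and misses [rep a], so it is
    empty; [rep b] makes the inclusion strict. *)
Lemma side_proper a b : live a -> live b -> a != b ->
  rep a \in side b -> (#|side a| < #|side b|)%N.
Proof.
move=> la lb ab ra; have nb := laminar la lb ab ra.
have uab := unlinked_below_pair oQ la lb ab.
have uba : ~~ linked phi beta Q b a by rewrite linked_sym.
have cM : closed Q (side a :\: side b).
  apply: closed_sub => -[i x]; rewrite !in_setD => /andP[hb ha].
  have ia : i != a by apply: contraNneq hb => ->; rewrite unlinked_end.
  have ib : i != b by apply: contraTneq ha => ->; rewrite unlinked_end.
  by rewrite !side_step // ha hb.
apply: proper_card; apply/properP; split; last first.
  by exists (rep b); rewrite ?rep_side.
apply/subsetP=> h hP; have := closed_onecyc h (rep a) oQ cM.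
by rewrite !in_setD ra hP andbT /= => /negbFE.
Qed.

Definition flipped L : {set 'I_n} := [set i | (i \in Q) (+) (i \in L)].

Lemma toggle_flipped a L : toggle a (flipped L) = flipped (toggle a L).
Proof. by apply/setP=> i; rewrite !inE addbA. Qed.

Section FixedL.
Variable L : {set 'I_n}.
Hypothesis Ll : forall a, a \in L -> live a.

Lemma side_closed a : a \in L -> closed (flipped L) (side a).
Proof.
move=> aL; apply: (closed_change (closed_side _ _ _ _)) => i.
have -> : ((i \in toggle a Q) != (i \in flipped L)) = ((i == a) != (i \in L)).
  by rewrite !inE; case: (i \in Q); case: (i == a); case: (i \in L).
have [->|ia] := eqVneq i a; first by rewrite aL.
rewrite eq_sym eqbF_neg negbK => iL.
have ai : a != i by rewrite eq_sym.
by rewrite !unlinked_end ?(unlinked_below_pair oQ (Ll aL) (Ll iL) ai).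
Qed.

Lemma rep_beta a : a \in L -> ~~ R (flipped L) beta (rep a).
Proof.
move=> aL; apply/negP=> /(closed_same (side_closed aL)).
by rewrite rep_side // (negPf (beta_side _ _ _ _)).
Qed.

Lemma rep_inj a b : a \in L -> b \in L -> R (flipped L) (rep a) (rep b) -> a = b.
Proof.
move=> aL bL ab; apply/eqP/negPn/negP=> nab.
have rb := closed_same (side_closed aL) ab; rewrite rep_side // in rb.
have ra := closed_same (side_closed bL) ab; rewrite rep_side // in ra.
by have := laminar (Ll aL) (Ll bL) nab ra; rewrite -rb.
Qed.

Lemma flipped_split a : a \in L -> ~~ R (flipped L) (a, false) (a, true).
Proof.
move=> aL; apply/negP=> /(closed_same (side_closed aL)) E.
by have := self_linked beta a oQ; rewrite /linked E eqxx.
Qed.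

End FixedL.

Lemma onecyc_ncyc : ncyc phi Q = 1%N.
Proof.
rewrite /ncyc /porbits -(cards1 (porbit (state_perm phi Q) beta)).
apply: eq_card => C; rewrite inE; apply/imsetP/eqP => [[h _ ->]|->]; last by exists beta.
by apply/esym/same_circle_porbit/(onecycP _ _ oQ).
Qed.

Lemma ncyc_flipped L : (forall a, a \in L -> live a) -> ncyc phi (flipped L) = #|L|.+1.
Proof.
move: {2}#|L| (erefl #|L|) => m; elim: m L => [|m IH] L Lm Ll.
  have -> : L = set0 by apply/eqP; rewrite -cards_eq0 Lm.
  rewrite cards0 -onecyc_ncyc; congr (ncyc phi _).
  by apply/setP=> i; rewrite !inE addbF.
have [a aL] : exists a, a \in L by apply/set0Pn; rewrite -cards_eq0 Lm.
have tL : toggle a L = L :\ a.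
  by apply/setP=> i; rewrite !inE; case: eqVneq => [->|]; rewrite ?aL ?addbF.
have cL : #|L :\ a| = m by move: Lm; rewrite (cardsD1 a) aL => -[].
have := ncyc_toggle phi a (flipped L); rewrite toggle_flipped tL IH ?cL //; last first.
  by move=> b; rewrite inE => /andP[_ /Ll].
by rewrite (negPf (flipped_split Ll aL)) Lm; lia.
Qed.

(** The circles of [beta] and of the [rep a] are pairwise distinct, and their number already equals
    [#|L|.+1], the number of all circles. *)
Lemma rep_cover L h : (forall a, a \in L -> live a) ->
  R (flipped L) beta h \/ exists2 a, a \in L & R (flipped L) (rep a) h.
Proof.
move=> Ll; pose orb := porbit (state_perm phi (flipped L)).
pose reps := orb beta |: [set orb (rep a) | a in L].
have sub : reps \subset porbits (state_perm phi (flipped L)).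
  apply/subsetP=> C; rewrite !inE => /orP[/eqP->|/imsetP[a _ ->]]; exact: imset_f.
have card : #|reps| = #|porbits (state_perm phi (flipped L))|.
  rewrite -/(ncyc _ _) ncyc_flipped // cardsU1 card_in_imset => [|a b aL bL E].
    case: imsetP => // -[a aL E]; case/negP: (rep_beta Ll aL).
    by rewrite /same_circle -eq_porbit_mem eq_sym; apply/eqP.
  by apply: (rep_inj Ll aL bL); rewrite /same_circle -eq_porbit_mem eq_sym; apply/eqP.
have : orb h \in reps.
  suff -> : reps = porbits (state_perm phi (flipped L)) by apply: imset_f.
  by apply/eqP; rewrite eqEcard sub card leqnn.
rewrite !inE => /orP[/eqP E|/imsetP[a aL E]]; [left|right; exists a => //];
  by rewrite /same_circle -/(orb _) -E porbit_id.
Qed.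

Lemma labels_inj L Y Y' : (forall a, a \in L -> live a) ->
  closed (flipped L) Y -> closed (flipped L) Y' -> beta \in Y -> beta \in Y' ->
  (forall a, a \in L -> (rep a \in Y) = (rep a \in Y')) -> Y = Y'.
Proof.
move=> Ll cY cY' bY bY' E; apply/setP=> h.
have [bh|[a aL ah]] := rep_cover h Ll.
  by rewrite -(closed_same cY bh) -(closed_same cY' bh) bY.
by rewrite -(closed_same cY ah) -(closed_same cY' ah) E.
Qed.

Lemma labels_ex L (S : {set 'I_n}) : (forall a, a \in L -> live a) ->
  exists Y, [/\ closed (flipped L) Y, beta \in Y &
    forall a, a \in L -> (rep a \in Y) = (a \in S)].
Proof.
move=> Ll; pose s := flipped L.
exists [set h | R s beta h || [exists a in L, (a \in S) && R s (rep a) h]].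
split; first 1 last.
- by rewrite inE same_circle_refl.
- move=> a aL; rewrite inE (negPf (rep_beta Ll aL)) /=.
  apply/exists_inP/idP => [[b bL /andP[bS]] /(rep_inj Ll bL aL) <- //|aS].
  by exists a; rewrite ?aS ?same_circle_refl.
apply/closedP=> h k hk; rewrite !inE (same_circle_r _ hk); congr (_ || _).
by apply: eq_existsb => a; rewrite (same_circle_r _ hk).
Qed.

Section Step.
Variables (L : {set 'I_n}) (c : 'I_n).
Hypothesis Ll : forall a, a \in L -> live a.
Hypotheses (cl : live c) (cL : c \notin L).

Let cLl a : a \in toggle c L -> live a.
Proof.
by rewrite toggleU // inE => /orP[/set1P-> // | /Ll].
Qed.

Lemma step_same_circle : R (flipped L) (c, false) (c, true).
Proof.
have cc : c \in toggle c L by rewrite in_toggle.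
by have := flipped_split cLl cc; rewrite -toggle_flipped same_circle_toggle negbK.
Qed.

(* Applied to [beta] or to some [rep a]: [h] represents the circle split by [c]. *)
Definition is_parent h := circles_at (flipped L) c h /\ h \notin side c.

Lemma parent_corep h : is_parent h -> R (toggle c (flipped L)) h (corep c).
Proof.
case=> ha hc; move: ha; rewrite -aff_toggle (circles_at_rep _ beta _ Q) ![R _ _ h]same_circle_sym.
case/orP=> // hr; have cc : c \in toggle c L by rewrite in_toggle.
move: (side_closed cLl cc); rewrite -toggle_flipped => /closed_same/(_ hr) E.
by rewrite E rep_side in hc.
Qed.

(** If the circle of [rep a] meets [c], then [c], being unlinked from [a], has both ends in
    [side a]; so the region of [c] is nested in that of [a]. *)
Lemma rep_parent a : a \in L -> circles_at (flipped L) c (rep a) ->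
  is_parent (rep a) /\ (#|side c| < #|side a|)%N.
Proof.
move=> aL aa; have ca : c != a by apply: contraNneq cL => ->.
have ra : rep c \in side a.
  have r0 := step_same_circle.
  move: aa; rewrite circles_atE => /orP[] /(closed_same (side_closed Ll aL));
    by rewrite rep_side // unlinked_end // (unlinked_below_pair oQ (Ll aL) cl) // eq_sym.
split; last exact: side_proper cl (Ll aL) ca ra.
by split=> //; apply: laminar cl (Ll aL) ca ra.
Qed.

Lemma parent_ex : is_parent beta \/ exists2 a, a \in L & is_parent (rep a).
Proof.
have [b0|[a aL a0]] := rep_cover (c, false) Ll.
  by left; split; rewrite ?beta_side // circles_atE same_circle_sym b0.
by right; exists a => //; apply: (rep_parent aL _).1; rewrite circles_atE same_circle_sym a0.
Qed.

End Step.
End Regions.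

(** * The matching *)

Section EdgeInInterval.
Variables (n : nat) (phi : {perm hedge n}) (beta : hedge n).
Variables (Q L : {set 'I_n}) (c : 'I_n) (Y0 Y1 : {set hedge n}).
Local Notation R := (same_circle phi).
Local Notation closed := (closed phi).
Local Notation circles_at := (circles_at phi).
Local Notation side := (side phi beta Q).
Local Notation rep := (rep phi beta Q).
Local Notation corep := (corep phi beta Q).
Local Notation live := (unlinked_below phi beta Q).
Local Notation s0 := (flipped Q L).
Local Notation s1 := (toggle c (flipped Q L)).
Hypotheses (oQ : onecyc phi Q) (Ll : forall a, a \in L -> live a).
Hypotheses (cl : live c) (cL : c \notin L).
Hypotheses (cY0 : closed s0 Y0) (cY1 : closed s1 Y1) (bY0 : beta \in Y0) (bY1 : beta \in Y1).

(* [Y0] labels the state where [c] does not split, [Y1] the one where it does;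
   the Khovanov map goes from [Y0] to [Y1] if [c \notin Q], else back. *)
Definition edge_ok : Prop :=
  (forall h, ~~ circles_at s0 c h -> (h \in Y1) = (h \in Y0)) /\
  ((rep c \in Y1) + (corep c \in Y1) = ((c, false) \in Y0) + (c \notin Q))%N.

Lemma ends_rep (Y : {set hedge n}) : ((rep c \in Y) + (corep c \in Y) =
  ((c, false) \in Y) + ((c, true) \in Y))%N.
Proof. by rewrite /corep /rep; case: ifP => //= _; rewrite addnC. Qed.

Lemma edge_coef_ext : c \notin Q -> edge_coef phi s0 c Y0 Y1 <-> edge_ok.
Proof.
move=> cQ; rewrite /edge_coef (step_same_circle oQ Ll cl cL) /edge_ok ends_rep cQ addn1.
split=> [/andP[/forallP H /eqP E]|[H E]].
  by split=> // h /(implyP (H h))/eqP.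
by rewrite E eqxx andbT; apply/forallP=> h; apply/implyP=> /H->.
Qed.

Lemma edge_coef_int : c \in Q -> edge_coef phi s1 c Y1 Y0 <-> edge_ok.
Proof.
move=> cQ; rewrite /edge_coef same_circle_toggle (step_same_circle oQ Ll cl cL) /= /edge_ok ends_rep cQ addn0.
split=> [/andP[/forallP H /eqP E]|[H E]].
  by split=> // h ah; have := H h; rewrite aff_toggle ah => /eqP.
by rewrite E eqxx andbT; apply/forallP=> h; apply/implyP; rewrite aff_toggle => /H->.
Qed.

Lemma parent_labels h : is_parent phi beta Q L c h ->
  ((h \in Y0) = ((c, false) \in Y0)) * ((h \in Y1) = (corep c \in Y1)).
Proof.
move=> ph; split; last exact: closed_same cY1 (parent_corep oQ Ll cl cL ph).
case: ph => /orP[] /(closed_same cY0) <- // _.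
by apply/esym/(closed_same cY0)/(step_same_circle oQ Ll cl cL).
Qed.

Lemma unchanged_or_parent a : a \in L -> edge_ok ->
  (rep a \in Y1) = (rep a \in Y0) \/ is_parent phi beta Q L c (rep a) /\
    (#|side c| < #|side a|)%N.
Proof.
move=> aL [E _]; have [aa|na] := boolP (circles_at s0 c (rep a)).
  by right; apply: rep_parent.
by left; apply: E.
Qed.

Definition main_move : Prop :=
  (rep c \in Y1) = (c \notin Q) /\ forall a, a \in L -> (rep a \in Y1) = (rep a \in Y0).

(** The circle of [c] keeps its critical label and the parent changes. In the direction of the
    differential the parent always goes from 1 to x: towards [Y1] for [c] outside [Q], towards [Y0]
    for [c] in [Q]. *)
Definition parent_move : Prop :=
  (rep c \in Y1) = (c \in Q) /\ exists2 a, a \in L &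
  [/\ (#|side c| < #|side a|)%N, (rep a \in Y0) = (c \in Q), (rep a \in Y1) = (c \notin Q) &
     forall b, b \in L -> b != a -> (rep b \in Y1) = (rep b \in Y0)].

Lemma edge_cases : edge_ok -> main_move \/ parent_move.
Proof.
move=> ok; have [ok1 ok2] := ok.
have [u|u] := eqVneq (rep c \in Y1) (c \notin Q).
  left; split=> // a aL; have [//|[pa _]] := unchanged_or_parent aL ok.
  rewrite !(parent_labels pa); move: ok2; rewrite u.
  by case: (_ \in Y1); case: (_ \in Y0); case: (_ \in Q).
right; have {}u : (rep c \in Y1) = (c \in Q) by move: u; case: (_ \in Y1); case: (_ \in Q).
split=> //.
have v0 : (((c, false) \in Y0) = (c \in Q)) * ((corep c \in Y1) = (c \notin Q)).
  by move: ok2; rewrite u; case: (_ \in Q); case: (_ \in Y1); case: (_ \in Y0).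
(* By [v0] the parent changes its label, which the base circle never does. *)
case: (parent_ex oQ Ll cl cL) => [pb|[a aL pa]].
  by have := parent_labels pb; rewrite !v0 bY0 bY1; case: (_ \in Q) => -[].
exists a => //; have [aa _] := pa; rewrite !(parent_labels pa) !v0; split=> //.
  exact: (rep_parent oQ Ll cl cL aL aa).2.
move=> b bL ba; have [//|[[ab _] _]] := unchanged_or_parent bL ok.
case/eqP: ba; apply: (rep_inj oQ Ll bL aL).
have to_c h : circles_at s0 c h -> R s0 (c, false) h.
  by case/orP=> // hc; apply: same_circle_trans (step_same_circle oQ Ll cl cL) hc.
by rewrite -(same_circle_l _ (to_c _ ab)); apply: to_c.
Qed.

Lemma main_edge : main_move -> edge_ok.
Proof.
case=> u same; split=> [h nh|].
  have R1 k : R s0 k h -> R s1 k h by rewrite !(same_circle_sym _ _ _ h) aff_stable.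
  have [bh|[a aL ah]] := rep_cover oQ h Ll.
    by rewrite -(closed_same cY0 bh) bY0 -(closed_same cY1 (R1 _ bh)).
  by rewrite -(closed_same cY0 ah) -same // (closed_same cY1 (R1 _ ah)).
rewrite u addnC; congr (_ + _)%N.
case: (parent_ex oQ Ll cl cL) => [pb|[a aL pa]].
  by rewrite -!(parent_labels pb) bY0 bY1.
by rewrite -!(parent_labels pa) same.
Qed.

End EdgeInInterval.

Section Matching.
Variables (n : nat) (phi : {perm hedge n}) (beta : hedge n).
Variables (K : finType) (st : K -> {set 'I_n}) (lab : K -> {set hedge n}).
Variable d : K -> K -> int.
Local Notation closed := (closed phi).
Local Notation live := (unlinked_below phi beta).
Local Notation rep := (rep phi beta).
Local Notation side := (side phi beta).
Hypothesis M : cube_model phi beta st lab d.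
Hypothesis conn : exists Q, onecyc phi Q.

Definition Qof y : {set 'I_n} :=
  odflt set0 [pick Q | onecyc phi Q && interval phi beta (st y) Q].

Lemma QofP y : onecyc phi (Qof y) /\ interval phi beta (st y) (Qof y).
Proof.
rewrite /Qof; case: pickP => [Q /andP[] //|no].
by have [Q HQ] := interval_ex beta (st y) conn; rewrite no in HQ.
Qed.

Lemma Qof_eq y Q : onecyc phi Q -> interval phi beta (st y) Q -> Qof y = Q.
Proof. by have [o i] := QofP y => oQ iQ; apply: interval_uniq o oQ i iQ. Qed.

Definition Lof y : {set 'I_n} := [set i | (i \in st y) (+) (i \in Qof y)].

Lemma stE y : st y = flipped (Qof y) (Lof y).
Proof. by apply/setP=> i; rewrite !inE addbCA addbb addbF. Qed.

Lemma Lof_live y a : a \in Lof y -> live (Qof y) a.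
Proof.
rewrite inE; have [_ /forallP/(_ a)] := QofP y.
by case/orP=> // /eqP->; rewrite addbb.
Qed.

Definition lbl y a := rep (Qof y) a \in lab y.

Lemma gen_uniq x y : Qof x = Qof y -> st x = st y ->
  (forall a, a \in Lof x -> lbl x a = lbl y a) -> x = y.
Proof.
move=> eQ es el; apply: (cube_inj M) => //.
have [oQ _] := QofP x; have cx := cube_closed M x; have cy := cube_closed M y.
rewrite -es !stE in cx cy; have := (cube_base M x); have := (cube_base M y) => b1 b2.
apply: (labels_inj oQ (@Lof_live x) cx cy b2 b1) => a aL.
by have := el _ aL; rewrite /lbl -eQ.
Qed.

Lemma gen_ex (Q L S : {set 'I_n}) : onecyc phi Q -> (forall a, a \in L -> live Q a) ->
  exists y, [/\ Qof y = Q, st y = flipped Q L & forall a, a \in L -> lbl y a = (a \in S)].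
Proof.
move=> oQ Ll; have [Y [cY bY YS]] := labels_ex oQ S Ll.
have [y [sy ly]] := cube_surj M cY bY.
have Qy : Qof y = Q.
  apply: Qof_eq => //; apply/forallP=> a; rewrite sy inE.
  by have [/Ll->|_] := boolP (a \in L); rewrite ?orbT // addbF eqxx.
by exists y; split=> // a aL; rewrite /lbl Qy ly YS.
Qed.

Lemma Lof_flipped y (L : {set 'I_n}) : st y = flipped (Qof y) L -> Lof y = L.
Proof. by move=> sy; apply/setP=> i; rewrite inE sy inE addbAC addbb addFb. Qed.

(* A live edge is critical when it is split off with the label surviving the
   local Gaussian elimination: label 1 outside [Q], label x inside. *)
Definition Ncrit y : {set 'I_n} :=
  [set a | live (Qof y) a && ~~ ((a \in Lof y) && (lbl y a == (a \in Qof y)))].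

Lemma in_Ncrit y a : (a \in Ncrit y) =
  live (Qof y) a && ~~ ((a \in Lof y) && (lbl y a == (a \in Qof y))).
Proof. by rewrite inE. Qed.

Definition pivot y : option 'I_n := [pick a in Ncrit y].
Definition lowgen y := if pivot y is Some a then a \notin st y else false.
Definition highgen y := if pivot y is Some a then a \in st y else false.

(** A relation for an arbitrary edge [a], because a term of the differential may realise a match at
    an edge that is not known to be the pivot. *)
Definition mates a y z :=
  [/\ Qof z = Qof y, st z = toggle a (st y),
      forall b, b \in Lof y -> b != a -> lbl z b = lbl y b &
      a \in Lof z -> lbl z a = (a \notin Qof y)].

Lemma Lof_tog a y z : Qof z = Qof y -> st z = toggle a (st y) -> Lof z = toggle a (Lof y).
Proof. by move=> e1 e2; apply/setP=> i; rewrite !inE e1 e2 inE addbAC. Qed.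

Lemma mates_ex a y : a \in Ncrit y -> exists z, mates a y z.
Proof.
rewrite in_Ncrit => /andP[la _]; have [oQ _] := QofP y.
have Ll b : b \in toggle a (Lof y) -> live (Qof y) b.
  by have [->|ba] := eqVneq b a => //; rewrite in_toggle_neq // => /Lof_live.
pose S := [set b | if b == a then a \notin Qof y else lbl y b].
have [z [Qz sz lz]] := gen_ex S oQ Ll; exists z; split=> //.
- by rewrite sz -toggle_flipped -stE.
- by move=> b bL ba; rewrite lz ?in_toggle_neq // inE (negPf ba).
- by rewrite (Lof_flipped (y := z) (L := toggle a (Lof y))) ?Qz // => /lz->; rewrite inE eqxx.
Qed.

Lemma mates_uniq a y z z' : mates a y z -> mates a y z' -> z = z'.
Proof.
move=> [Q1 s1 l1 a1] [Q2 s2 l2 a2]; apply: gen_uniq; rewrite ?Q1 ?s1 // => b.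
have Lz' : Lof z' = Lof z by rewrite (Lof_tog Q1 s1) (Lof_tog Q2 s2).
have [->|ba] := eqVneq b a; first by move=> aL; rewrite a1 ?a2 ?Lz'.
by rewrite (Lof_tog Q1 s1) in_toggle_neq // => bL; rewrite l1 ?l2.
Qed.

Lemma mates_Ncrit a y z : a \in Ncrit y -> mates a y z -> Ncrit z = Ncrit y.
Proof.
move=> aN [Qz sz lz az]; apply/setP=> b; have [->|ba] := eqVneq b a.
  rewrite aN in_Ncrit Qz; move: aN; rewrite in_Ncrit => /andP[-> _] /=.
  by rewrite negb_and; have [/az->|//] := boolP (a \in Lof z); case: (a \in Qof y).
rewrite !in_Ncrit Qz (Lof_tog Qz sz) in_toggle_neq //.
by have [bL|//] := boolP (b \in Lof y); rewrite lz.
Qed.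

Lemma mates_sym a y z : a \in Ncrit y -> mates a y z -> mates a z y.
Proof.
move=> aN [Qz sz lz az]; split; first by rewrite Qz.
- by rewrite sz toggleK.
- by move=> b bL ba; rewrite lz // -(in_toggle_neq (Lof y) ba) -(Lof_tog Qz sz).
rewrite Qz => aL; move: aN; rewrite in_Ncrit aL => /andP[_] /=.
by case: (lbl y a); case: (a \in Qof y).
Qed.

Definition matesb a y z := [&& Qof z == Qof y, st z == toggle a (st y),
  [forall b, (b \in Lof y) && (b != a) ==> (lbl z b == lbl y b)] &
  (a \in Lof z) ==> (lbl z a == (a \notin Qof y))].

Lemma matesP a y z : reflect (mates a y z) (matesb a y z).
Proof.
apply: (iffP and4P) => [[/eqP e1 /eqP e2 /forallP H /implyP e4]|[-> -> H e4]].
  split=> // [b bL ba|aL]; last by apply/eqP/e4.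
  by apply/eqP; move/implyP: (H b); apply; rewrite bL.
split=> //; last by apply/implyP=> /e4->.
by apply/forallP=> b; apply/implyP=> /andP[bL ba]; rewrite H.
Qed.

Definition mate y : K :=
  if pivot y is Some a then odflt y [pick z | matesb a y z] else y.

Lemma mateP y a : pivot y = Some a -> a \in Ncrit y /\ mates a y (mate y).
Proof.
move=> pa; have aN : a \in Ncrit y.
  by move: pa; rewrite /pivot; case: pickP => // b bN [<-].
split=> //; rewrite /mate pa; case: pickP => [z /matesP //|no].
by have [z /matesP] := mates_ex aN; rewrite no.
Qed.

Lemma mate_pivot y a : pivot y = Some a -> pivot (mate y) = Some a.
Proof. by move=> pa; have [aN /(mates_Ncrit aN) E] := mateP pa; rewrite -pa /pivot E. Qed.

Lemma pivot_some y : lowgen y || highgen y -> exists a, pivot y = Some a.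
Proof. by rewrite /lowgen /highgen; case: pivot => // a _; exists a. Qed.

Lemma mateK y : lowgen y || highgen y -> mate (mate y) = y.
Proof.
case/pivot_some=> a pa; have [aN m1] := mateP pa.
have [_ m2] := mateP (mate_pivot pa).
exact: mates_uniq m2 (mates_sym aN m1).
Qed.

Lemma mate_st y a : pivot y = Some a -> st (mate y) = toggle a (st y).
Proof. by move=> pa; have [_ []] := mateP pa. Qed.

Lemma mate_Q y : Qof (mate y) = Qof y.
Proof.
by case pa: (pivot y) => [a|]; [have [_ []] := mateP pa | rewrite /mate pa].
Qed.

Lemma mate_Ncrit y : Ncrit (mate y) = Ncrit y.
Proof.
case pa: (pivot y) => [a|]; last by rewrite /mate pa.
by have [aN /(mates_Ncrit aN)] := mateP pa.
Qed.

Lemma mate_low y : lowgen y -> highgen (mate y).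
Proof.
move=> ly; have [a pa] : exists a, pivot y = Some a by apply: pivot_some; rewrite ly.
by move: ly; rewrite /lowgen /highgen (mate_pivot pa) pa (mate_st pa) in_toggle.
Qed.

Lemma mate_high y : highgen y -> lowgen (mate y).
Proof.
move=> hy; have [a pa] : exists a, pivot y = Some a by apply: pivot_some; rewrite hy orbT.
by move: hy; rewrite /lowgen /highgen (mate_pivot pa) pa (mate_st pa) in_toggle negbK.
Qed.

Lemma low_not_high y : lowgen y -> highgen y = false.
Proof. by rewrite /lowgen /highgen; case: pivot => // a /negPf. Qed.

Lemma neither y : (~~ lowgen y && ~~ highgen y) = (Ncrit y == set0).
Proof.
rewrite /lowgen /highgen /pivot; case: pickP => [a aN|no].
  by rewrite negbK andbN; apply/esym/negbTE/set0Pn; exists a.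
by apply/esym/eqP/setP=> a; rewrite no inE.
Qed.

Definition theta y : int :=
  \sum_(a in Ncrit y) (if a \in Qof y then - #|side (Qof y) a|%:Z else #|side (Qof y) a|%:Z).

(** Both ingredients are unchanged by [mate], so comparing with [y] and with [mate y] is the
    same. *)
Definition gen_lt y z : bool :=
  (binary_weight (Qof y) < binary_weight (Qof z))%N || (Qof y == Qof z) && (theta y < theta z).

Lemma gen_lt_irr y : gen_lt y y = false.
Proof. by rewrite /gen_lt ltnn ltxx andbF. Qed.

Lemma gen_lt_trans x y z : gen_lt x y -> gen_lt y z -> gen_lt x z.
Proof.
rewrite /gen_lt => /orP[l1|/andP[/eqP e1 l1]] /orP[l2|/andP[/eqP e2 l2]].
- by rewrite (ltn_trans l1 l2).
- by rewrite -e2 l1.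
- by rewrite e1 l2.
- by rewrite e1 e2 eqxx (lt_trans l1 l2) orbT.
Qed.

(** [p] and [q] are the region sizes of [c] and of its parent [a]; [i] and [j] say whether these
    edges lie in [Q]. The two sides differ by [q - p] in each case. *)
Lemma two_status_lt (p q : nat) (i j : bool) : (p < q)%N ->
  (if ~~ i then if i then - p%:Z else p%:Z else 0) +
    (if j then if j then - q%:Z else q%:Z else 0) <
  (if i then if i then - p%:Z else p%:Z else 0) +
    (if ~~ j then if j then - q%:Z else q%:Z else 0) :> int.
Proof. by case: i; case: j => /= pq; lia. Qed.

Section SameInterval.
Variables (x y : K) (c : 'I_n).
Hypotheses (cx : c \notin st x) (sy : st y = toggle c (st x)) (eQ : Qof y = Qof x).
Local Notation Q := (Qof x).

(* The state in which [c] is not split comes first iff [c \notin Q]. *)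
Let lo := if c \in Q then y else x.
Let hi := if c \in Q then x else y.

Lemma low_xst : st lo = flipped Q (Lof lo).
Proof. by rewrite stE /lo; case: ifP; rewrite ?eQ. Qed.

Lemma hi_tog : st hi = toggle c (flipped Q (Lof lo)).
Proof. by rewrite -low_xst /lo /hi; case: ifP; rewrite sy ?toggleK. Qed.

Lemma c_lo : c \notin Lof lo.
Proof.
rewrite inE /lo; case: ifP => cQ; rewrite ?eQ cQ ?(negPf cx) //.
by rewrite sy in_toggle cx.
Qed.

Lemma c_live : live Q c.
Proof.
have [cL|] := boolP (c \in Lof x); first exact: Lof_live.
rewrite inE (negPf cx) /= => cQ; rewrite -eQ; apply: Lof_live.
by rewrite inE eQ sy in_toggle cx (negPf cQ).
Qed.

Lemma Llo a : a \in Lof lo -> live Q a.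
Proof. by move/Lof_live; rewrite /lo; case: ifP; rewrite ?eQ. Qed.

Lemma same_coef : edge_coef phi (st x) c (lab x) (lab y) <->
  edge_ok phi beta Q (Lof lo) c (lab lo) (lab hi).
Proof.
have [oQ _] := QofP x.
have cl := low_xst; have ch := hi_tog; have cc := c_lo; have Ll := Llo.
rewrite /lo /hi in cl ch cc Ll *.
move: cl ch cc Ll; case: ifP => cQ cl ch cc Ll.
  by rewrite ch; apply: (edge_coef_int _ _ oQ Ll c_live cc).
by rewrite cl; apply: (edge_coef_ext _ _ oQ Ll c_live cc); rewrite cQ.
Qed.

Lemma lo_hi_model : [/\ closed (flipped Q (Lof lo)) (lab lo),
  closed (toggle c (flipped Q (Lof lo))) (lab hi), beta \in lab lo & beta \in lab hi].
Proof.
by rewrite -hi_tog -low_xst; split; [exact: (cube_closed M) | exact: (cube_closed M)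
  | exact: (cube_base M) | exact: (cube_base M)].
Qed.

Lemma Lof_lo b : b != c -> ((b \in Lof x) = (b \in Lof lo)) * ((b \in Lof y) = (b \in Lof lo)).
Proof.
move=> bc; have E : (b \in Lof y) = (b \in Lof x).
  by rewrite (Lof_tog eQ sy) in_toggle_neq.
by rewrite /lo E; case: ifP; rewrite ?E.
Qed.

Lemma c_Lof : ((c \in Lof x) = (c \in Q)) * ((c \in Lof y) = (c \notin Q)).
Proof. by split; rewrite inE ?eQ ?sy ?in_toggle (negPf cx). Qed.

Lemma same_main : main_move phi beta Q (Lof lo) c (lab lo) (lab hi) <->
  mates c x y /\ c \in Ncrit x.
Proof.
rewrite /main_move in_Ncrit c_live !c_Lof /mates eQ; split.
  case=> u same; split.
    split=> // [b bL bc|]; last first.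
      by rewrite c_Lof.2 => cQ; move: u; rewrite /lbl eQ /hi (negPf cQ).
    rewrite (Lof_lo bc).1 in bL; have := same _ bL.
    by rewrite /lbl eQ /lo /hi; case: ifP.
  by case: (boolP (c \in Q)) u => //= cQ; rewrite /lbl /hi cQ => ->.
case=> -[_ _ same u] Nc; split=> [|a aL].
  move: Nc u; rewrite c_Lof.2 /lbl eQ /hi.
  by case: (c \in Q) => /= [|_ /(_ isT) //]; case: (_ \in lab x).
have ac : a != c by apply: contraTneq aL => ->; rewrite c_lo.
have aLx : a \in Lof x by rewrite (Lof_lo ac).1.
by have := same a aLx ac; rewrite /lbl eQ /lo /hi; case: ifP.
Qed.

(** A parent move changes the noncritical status of [c] and of its parent, and of no other edge. *)
Lemma same_parent : parent_move phi beta Q (Lof lo) c (lab lo) (lab hi) ->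
  theta x < theta y.
Proof.
case=> u [a aL [lt a0 a1 same]].
have ac : a != c by apply: contraTneq aL => ->; rewrite c_lo.
have [aLx aLy] := Lof_lo ac; rewrite aL in aLx aLy.
have [ax ay] : lbl x a = false /\ lbl y a = true.
  by move: a0 a1; rewrite /lbl eQ /lo /hi; case: ifP => /= cQ -> ->.
have [cNx cNy] : (c \in Ncrit x) = (c \notin Q) /\ (c \in Ncrit y) = (c \in Q).
  rewrite !in_Ncrit eQ c_live !c_Lof; move: u; rewrite /lbl eQ /hi.
  by case: (c \in Q) => /= ->.
have [aNx aNy] : (a \in Ncrit x) = (a \in Q) /\ (a \in Ncrit y) = (a \notin Q).
  by rewrite !in_Ncrit aLx aLy eQ ax ay Llo //; case: (a \in Q).
have bN b : b != c -> b != a -> (b \in Ncrit x) = (b \in Ncrit y).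
  move=> bc ba; rewrite !in_Ncrit !(Lof_lo bc) eQ; congr (_ && ~~ _).
  apply: andb_id2l => bL; have := same b bL ba; rewrite /lbl eQ /lo /hi.
  by case: ifP => _ ->.
pose w b : int := if b \in Q then - #|side Q b|%:Z else #|side Q b|%:Z.
have thE z : Qof z = Q -> theta z = (if c \in Ncrit z then w c else 0) +
    ((if a \in Ncrit z then w a else 0) +
     \sum_(b | (b != c) && (b != a)) (if b \in Ncrit z then w b else 0)).
  by move=> Qz; rewrite /theta Qz big_mkcond (bigD1 c) //= (bigD1 a).
rewrite !thE // aNx aNy cNx cNy.
rewrite (eq_bigr (fun b => if b \in Ncrit y then w b else 0)) => [|b /andP[bc ba]]; last first.
  by rewrite bN.
by rewrite /w !addrA ltrD2r; apply: two_status_lt.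
Qed.

End SameInterval.

Lemma edge_lt_or_mates x y c : c \notin st x -> st y = toggle c (st x) ->
  edge_coef phi (st x) c (lab x) (lab y) -> gen_lt x y \/ mates c x y /\ c \in Ncrit x.
Proof.
move=> cx sy cf; have [oQ iQ] := QofP x; have [oQ' iQ'] := QofP y.
have [eQ|nQ] := eqVneq (Qof y) (Qof x); last first.
  left; apply/orP; left; rewrite sy in iQ'.
  by apply: (interval_lt oQ oQ' cx iQ iQ'); rewrite eq_sym.
have [cY0 cY1 bY0 bY1] := lo_hi_model sy eQ.
have cl := c_live cx sy eQ; have cL := c_lo cx sy eQ; have Ll := Llo (x := x) (y := y) (c := c) eQ.
move/(same_coef cx sy eQ)/(edge_cases oQ Ll cl cL cY0 cY1 bY0 bY1): cf.
case=> [/(same_main cx sy eQ)|/(same_parent cx sy eQ) lt]; first by right.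
by left; rewrite /gen_lt eQ eqxx lt orbT.
Qed.

Lemma mates_coef x y c : c \notin st x -> c \in Ncrit x -> mates c x y ->
  edge_coef phi (st x) c (lab x) (lab y).
Proof.
move=> cx cN m; have [eQ sy _ _] := m; have [oQ _] := QofP x.
have [cY0 cY1 bY0 bY1] := lo_hi_model sy eQ.
have cl := c_live cx sy eQ; have cL := c_lo cx sy eQ; have Ll := Llo (x := x) (y := y) (c := c) eQ.
apply/(same_coef cx sy eQ)/(main_edge oQ Ll cl cL cY0 cY1 bY0 bY1).
exact/(same_main cx sy eQ).
Qed.

Lemma theta_mate y : theta (mate y) = theta y.
Proof. by rewrite /theta mate_Ncrit mate_Q. Qed.

Lemma d_mate x : lowgen x -> d x (mate x) * d x (mate x) = 1.
Proof.
rewrite /lowgen; case px: (pivot x) => [a|] // ax; have [aN m] := mateP px.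
have [_ sm _ _] := m.
rewrite (cube_edge M ax sm) (mates_coef ax aN m) mulr1 /ksign.
by rewrite -exprD addnn -mul2n exprM sqrrN !expr1n.
Qed.

Lemma d_gen_lt x y : lowgen x -> highgen y -> d x y != 0 ->
  y = mate x \/ gen_lt x (mate y).
Proof.
move=> lx hy dxy; have [c [cx sy]] := cube_non_edge M dxy.
have cf : edge_coef phi (st x) c (lab x) (lab y).
  by move: dxy; rewrite (cube_edge M cx sy); case: edge_coef => //; rewrite mulr0 eqxx.
have [lt|[m cN]] := edge_lt_or_mates cx sy cf.
  by right; move: lt; rewrite /gen_lt mate_Q theta_mate.
(* Matched along [c], [x] and [y] have the same noncritical edges and hence the same pivot. It
   belongs to the state of [y] but not to that of [x], so it is [c]. *)
left; have E := mates_Ncrit cN m.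
move: lx hy; rewrite /lowgen /highgen /pivot E -/(pivot x).
case px: (pivot x) => [a|] // ax ay; have ac : a = c.
  by apply/eqP; apply: contraR ax => ac; rewrite sy in_toggle_neq // in ay.
have [_ m'] := mateP px; rewrite ac in m'.
exact: mates_uniq m m'.
Qed.

Lemma crit_ex Q : onecyc phi Q ->
  exists y, [/\ Qof y = Q, st y = flipped Q [set a | live Q a] & Ncrit y = set0].
Proof.
move=> oQ; have Ll a : a \in [set a | live Q a] -> live Q a by rewrite inE.
have [y [Qy sy ly]] := gen_ex Q oQ Ll; exists y; split=> //.
apply/setP=> a; rewrite in_Ncrit in_set0 Qy (@Lof_flipped y [set a | live Q a]) ?Qy //.
have [la|//] := boolP (live Q a); have aL : a \in [set a | live Q a] by rewrite inE.
by rewrite aL ly // eqxx.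
Qed.

Lemma crit_Lof y : Ncrit y = set0 -> Lof y = [set a | live (Qof y) a] /\
  forall a, a \in Lof y -> lbl y a = (a \in Qof y).
Proof.
move=> /setP N0; have H a : live (Qof y) a -> (a \in Lof y) && (lbl y a == (a \in Qof y)).
  by move=> la; have := N0 a; rewrite in_Ncrit la in_set0 => /negbFE.
split=> [|a /Lof_live /H /andP[_ /eqP //]].
apply/setP=> a; rewrite [RHS]inE; apply/idP/idP=> [/Lof_live //|/H /andP[] //].
Qed.

Lemma crit_uniq x y : Qof x = Qof y -> Ncrit x = set0 -> Ncrit y = set0 -> x = y.
Proof.
move=> eQ /crit_Lof[Lx lx] /crit_Lof[Ly ly].
have eL : Lof x = Lof y by rewrite Lx Ly eQ.
apply: gen_uniq => // [|a aL]; first by rewrite !stE eQ eL.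
by rewrite lx // ly -?eL // eQ.
Qed.

Definition critgen Q (y0 : K) : K :=
  odflt y0 [pick y | (Qof y == Q) && (Ncrit y == set0)].

Lemma critgenP Q y0 : onecyc phi Q ->
  Qof (critgen Q y0) = Q /\ Ncrit (critgen Q y0) = set0.
Proof.
move=> oQ; rewrite /critgen; case: pickP => [y /andP[/eqP-> /eqP->] //|no].
by have [y [Qy _ Ny]] := crit_ex oQ; have := no y; rewrite Qy Ny !eqxx.
Qed.

End Matching.

(** * From knot diagrams to permutations *)

Local Arguments i4 : simpl never.
Local Arguments partnerA : simpl never.
Local Arguments partnerB : simpl never.
Local Arguments hentry : simpl never.

Section Bridge.
Variables (n : nat) (D : knot_diagram n) (col : dart n -> bool).
Local Notation e := (kd_edge D).
Hypothesis eK : forall d, e (e d) = d.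
Hypothesis colF : forall d, col (dface D d) = col d.
Hypothesis colR : forall d, col (drot d) = ~~ col d.
Hypothesis einc : forall d, incoming D (e d) = ~~ incoming D d.
Hypothesis one_comp : forall d d', incoming D d -> incoming D d' ->
  fconnect (dstrand D) d d'.

Lemma i4E m : i4 m = (m %% 4)%N :> nat.
Proof. by rewrite /i4 inordK // ltn_mod. Qed.

Lemma drot_surj (d : dart n) : exists d', d = drot d'.
Proof.
case: d => i k; exists (i, i4 (k + 3)); rewrite /drot /=; congr (_, _).
by apply: ord_inj; rewrite !i4E modnDml; case: k => -[|[|[|[|]]]].
Qed.

Lemma col_e d : col (e d) = ~~ col d.
Proof. by have [d' ->] := drot_surj d; rewrite -/(dface D d') colF colR negbK. Qed.

Lemma col_odd i (k : 'I_4) : col (i, k) = col (i, ord0) (+) odd k.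
Proof.
have S m (lt : (m < 3)%N) : col (i, i4 m.+1) = ~~ col (i, i4 m).
  rewrite -colR; congr (col (_, _)); apply: ord_inj.
  by rewrite /= !i4E modnDml addn1.
have kE : k = i4 k by apply: ord_inj; rewrite /= i4E modn_small.
have -> : ord0 = i4 0 by apply: ord_inj; rewrite /= i4E.
rewrite {1}kE; case: k {kE} => -[|[|[|[|]]]] //= _; rewrite ?S ?negbK ?addbF ?addbT //.
Qed.

Lemma partnerAE (k : 'I_4) : partnerA k = (if odd k then k.-1 else k.+1) :> nat.
Proof. by rewrite i4E; case: k => -[|[|[|[|]]]]. Qed.

Lemma partnerBE (k : 'I_4) : partnerB k = (3 - k)%N :> nat.
Proof. by rewrite i4E; case: k => -[|[|[|[|]]]]. Qed.

Lemma hentryE (h : hedge n) :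
  ((hentry col h).1 = h.1) * ((hentry col h).2 = (h.2.*2 + col (h.1, ord0))%N :> nat).
Proof.
split=> //=; rewrite i4E /midcol col_odd i4E /= addbT.
by case: h.2; case: (col _).
Qed.

Lemma col_hentry h : col (hentry col h) = false.
Proof.
by rewrite [hentry _ _]surjective_pairing col_odd !hentryE oddD odd_double oddb addbb.
Qed.

Lemma arc_hentry h : arc_of (hentry col h) = h.
Proof.
rewrite /arc_of !hentryE; case: h => i x /=; congr (_, _).
by case: x; case: (col _).
Qed.

Lemma hentry_arc d : col d = false -> hentry col (arc_of d) = d.
Proof.
case: d => i k cd; rewrite [hentry _ _]surjective_pairing; congr (_, _).
apply: ord_inj; rewrite hentryE /=; move: cd; rewrite col_odd.
by case: (col _); case: k => -[|[|[|[|]]]].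
Qed.

(** Both smoothings join positions of opposite parity, and colours alternate around a crossing. With
    [col_e], every circle of every state alternates in colour; passing each arc from colour false to
    colour true orients all of them coherently. *)
Lemma sjoin_color s (d : dart n) : col (sjoin s d) = ~~ col d.
Proof.
case: d => i k; rewrite /sjoin /= col_odd [in RHS]col_odd.
by case: ifP => _; rewrite ?partnerAE ?partnerBE; case: k => -[|[|[|[|]]]] //=;
  rewrite ?addbT ?addbF ?negbK.
Qed.

Lemma sjoinK s (d : dart n) : sjoin s (sjoin s d) = d.
Proof.
case: d => i k; rewrite /sjoin /=; congr (_, _); apply: ord_inj.
by case: (i \in s); rewrite /= ?(partnerAE, partnerBE); case: k => -[|[|[|[|]]]].
Qed.

Lemma hexitE (h : hedge n) : hexit col h = @sjoin n set0 (hentry col h).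
Proof. by rewrite /hexit /sjoin in_set0. Qed.

Lemma hentry_sigma0 h : hentry col (sigma0 D col h) = e (hexit col h).
Proof. by apply: hentry_arc; rewrite col_e hexitE sjoin_color col_hentry. Qed.

Lemma sigma0_inj : injective (sigma0 D col).
Proof.
move=> h k /(congr1 (hentry col)); rewrite !hentry_sigma0 !hexitE.
move=> /(congr1 e); rewrite !eK => /(congr1 (@sjoin n set0)); rewrite !sjoinK.
by move=> /(congr1 (@arc_of n)); rewrite !arc_hentry.
Qed.

Definition diagram_perm : {perm hedge n} := perm sigma0_inj.
Local Notation phi := diagram_perm.

Lemma state_perm_sigmaQ s h : state_perm phi s h = sigmaQ D col s h.
Proof. by rewrite state_permE permE /flip /sigmaQ; case: ifP. Qed.

(** Each edge of the diagram has exactly one end of colour false, the entry of an A-arc; this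
    identifies edges of the diagram with half-edges. *)
Definition eta d : hedge n := arc_of (if col d then e d else d).

Lemma etaE d : eta d = arc_of (if col d then e d else d).
Proof. by []. Qed.

Lemma eta_e d : eta (e d) = eta d.
Proof. by rewrite /eta col_e eK; case: (col d). Qed.

Lemma eta_hentry h : eta (hentry col h) = h.
Proof. by rewrite /eta col_hentry arc_hentry. Qed.

Lemma eta_sjoin s d : col d = false -> eta (sjoin s d) = state_perm phi s (eta d).
Proof.
move=> cd; rewrite state_perm_sigmaQ /eta sjoin_color cd /= /sigmaQ /sigma0.
have -> : (arc_of d).1 = d.1 by [].
rewrite /sjoin; case: ifP => ds; congr (arc_of (e _)).
  (* The B-partner of a position is the A-partner of the opposite position, which is the exit of the
     other half-edge at the crossing. *)
  rewrite /hexit; congr (_, _); apply: ord_inj.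
  rewrite partnerBE partnerAE !hentryE /=.
  case: d {ds} cd => i k; rewrite col_odd /=.
  by case: (col _); case: k => -[|[|[|[|]]]].
by rewrite hexitE hentry_arc // /sjoin inE.
Qed.

Lemma eta_sjoin_same s d : same_circle phi s (eta d) (eta (sjoin s d)).
Proof.
have [cd|cd] := boolP (col d).
  have cs : col (sjoin s d) = false by rewrite sjoin_color cd.
  by have := same_circle_step phi s (eta (sjoin s d)); rewrite -eta_sjoin // sjoinK same_circle_sym.
by rewrite eta_sjoin ?same_circle_step //; apply: negbTE.
Qed.

Lemma srel_sym s : symmetric (srel D s).
Proof.
move=> d d'; rewrite /srel; congr (_ || _).
  by apply/eqP/eqP => ->.
by apply/eqP/eqP => ->; rewrite sjoinK.
Qed.

Lemma connectE s d d' : connect (srel D s) d d' = same_circle phi s (eta d) (eta d').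
Proof.
have csym := sym_connect_sym (srel_sym s).
apply/idP/idP.
  case/connectP=> p pp ->; elim: p d pp => [|x p IH] d /=; first by rewrite same_circle_refl.
  case/andP=> /orP[] /eqP-> /IH; first by rewrite eta_e.
  by apply: same_circle_trans; apply: eta_sjoin_same.
have step h : connect (srel D s) (hentry col h) (hentry col (state_perm phi s h)).
  have -> : state_perm phi s h = eta (sjoin s (hentry col h)).
    by rewrite eta_sjoin ?col_hentry // eta_hentry.
  rewrite /eta sjoin_color col_hentry hentry_arc ?col_e ?sjoin_color ?col_hentry //.
  apply: connect_trans (connect1 _) (connect1 _); last exact/orP/or_introl/eqxx.
  by apply/orP; right.
have toh x : connect (srel D s) x (hentry col (eta x)).
  rewrite /eta; case cx: (col x); last by rewrite hentry_arc ?connect0.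
  by rewrite hentry_arc ?col_e ?cx //; apply: connect1; rewrite /srel eqxx.
move=> /porbitP[m eE]; apply: connect_trans (toh d) _.
rewrite csym; apply: connect_trans (toh d') _; rewrite csym {}eE.
elim: m => [|m IH]; first by rewrite perm1 connect0.
by rewrite expgSr permM; apply: connect_trans IH (step _).
Qed.

Lemma eta_crossing s i k : same_circle phi s (i, false) (i, true) -> same_circle phi s (eta (i, k)) (i, false).
Proof.
move=> Ri; have go d : col d = false -> d.1 = i -> same_circle phi s (eta d) (i, false).
  move=> cd di; rewrite /eta cd /arc_of di; case: (_ <= _)%N; last exact: same_circle_refl.
  by rewrite same_circle_sym.
have [cd|cd] := boolP (col (i, k)); last by apply: go => //; apply: negbTE.
by apply: same_circle_trans (eta_sjoin_same s _) _; apply: go => //; rewrite sjoin_color cd.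
Qed.

(** In a state with the fewest circles no toggle can merge two, so the four darts at each crossing
    lie on one circle. Going straight through crossings never leaves that circle, and the single
    component of the knot visits every edge. *)
Lemma onecyc_ex : exists Q, onecyc phi Q.
Proof.
case: (@arg_minnP _ set0 predT (ncyc phi) isT) => Q _ minQ; exists Q.
have link i : same_circle phi Q (i, false) (i, true).
  apply/negPn/negP=> nR; have := minQ (toggle i Q) isT.
  by have := ncyc_toggle phi i Q; rewrite (negPf nR) /=; lia.
have opp d : same_circle phi Q (eta d) (eta (dstrand D d)).
  rewrite eta_e; case: d => i k; apply: same_circle_trans (eta_crossing k (link i)) _.
  by rewrite same_circle_sym; apply: eta_crossing.
have inc d d' : incoming D d -> incoming D d' -> same_circle phi Q (eta d) (eta d').
  move=> i1 i2; have /connectP[p pp ->] := one_comp i1 i2.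
  elim: p d {i1} pp => [|x p IH] d /=; first by rewrite same_circle_refl.
  by case/andP=> /eqP<- /IH; apply: same_circle_trans.
have mk d : exists2 d', incoming D d' & eta d' = eta d.
  by case: (boolP (incoming D d)) => i; [exists d | exists (e d); rewrite ?eta_e ?einc].
apply/onecycP=> h k; rewrite -(eta_hentry h) -(eta_hentry k).
have [d1 i1 <-] := mk (hentry col h); have [d2 i2 <-] := mk (hentry col k).
exact: inc.
Qed.

End Bridge.

(** * Counting circles and x-labels *)

Section Count.
Variables (n : nat) (phi : {perm hedge n}).
Implicit Types (s : {set 'I_n}) (h : hedge n) (Y : {set hedge n}) (m : seq (hedge n)).
Local Notation R := (same_circle phi).
Local Notation closed := (closed phi).
Local Notation circles_at := (circles_at phi).

Definition ncyc_in s Y := #|[set porbit (state_perm phi s) h | h in Y]|.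

Lemma transversal_size s m Y : transversal phi s m Y -> size m = ncyc_in s Y.
Proof.
move=> T; have cY := transversal_closed T; have /transversalP tm := T.
have mY h : h \in m -> h \in Y.
  move=> hm; have := tm h; case: (h \in Y) => // /eqP.
  by rewrite -leqn0 leqNgt -has_count; case: hasP => // -[]; exists h; rewrite ?same_circle_refl.
have um : uniq (map (porbit (state_perm phi s)) m).
  elim: m tm {mY T} => // x m IH; suff G (m' : seq (hedge n)) :
      (forall h, count (R s h) m' <= 1)%N -> uniq (map (porbit (state_perm phi s)) m').
    by move=> tm; apply: G => h; rewrite tm leq_b1.
  elim: m' {IH} => //= y m' IH le1; rewrite IH ?andbT => [|h]; last first.
    by have := le1 h; lia.
  apply/mapP=> -[z zm' /eqP]; rewrite eq_porbit_mem => yz.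
  have := le1 y; rewrite same_circle_refl; suff : (0 < count (R s y) m')%N by lia.
  by rewrite -has_count; apply/hasP; exists z => //; rewrite same_circle_sym.
rewrite -(size_map (porbit (state_perm phi s))) -(card_uniqP um); apply: eq_card => C.
apply/mapP/imsetP => -[h hm ->]; first by exists h => //; apply: mY.
have : has (R s h) m by rewrite has_count tm hm.
by case/hasP=> k km hk; exists k => //; apply: same_circle_porbit.
Qed.

Lemma ncyc_in_circles_at s c Y : closed s Y ->
  ncyc_in s Y = (ncyc_in s [set h in Y | ~~ circles_at s c h] +
    (if R s (c, false) (c, true) then ((c, false) \in Y : nat)
     else ((c, false) \in Y) + ((c, true) \in Y)))%N.
Proof.
move=> cY; have [m T] := transversal_ex cY; have /transversalP tm := T.
rewrite -(transversal_size T) -(count_predC (circles_at s c)) addnC; congr (_ + _)%N.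
  rewrite -size_filter; apply: transversal_size; apply/transversalP=> h; rewrite inE.
  rewrite count_filter; have [ah|nh] := boolP (circles_at s c h); rewrite /= ?andbF ?andbT.
    apply/eqP; rewrite -leqn0 leqNgt -has_count; apply/hasPn=> x _ /=.
    by apply/negP=> /andP[hx /negP[]]; move: ah; rewrite !circles_atE !(same_circle_r _ hx).
  rewrite -tm; apply: eq_count => x /=; case hx: (R s h x) => //=.
  by rewrite circles_atE -!(same_circle_r _ hx) -circles_atE.
have [Rs|nR] := boolP (R s (c, false) (c, true)).
  by rewrite -tm; apply: eq_count => x; rewrite circles_atE -(same_circle_l _ Rs) orbb.
by rewrite -!tm -count_merge //; apply: eq_count => x; rewrite same_circle_merge.
Qed.

Lemma ncyc_in_circles_off s c Y : (forall h, h \in Y -> ~~ circles_at s c h) ->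
  ncyc_in (toggle c s) Y = ncyc_in s Y.
Proof.
move=> nY; rewrite /ncyc_in; congr #|pred_of_set _|.
by apply: eq_in_imset => h /nY/aff_stable E; apply/setP=> x; apply: E.
Qed.

(** With the labels away from [c] fixed, the total number of x-circles determines the condition at
    [c]. In this form it can be compared with the quantum degree. *)
Lemma edge_coef_count s c Y Y' : closed s Y -> closed (toggle c s) Y' ->
  edge_coef phi s c Y Y' =
  [forall h, ~~ circles_at s c h ==> ((h \in Y') == (h \in Y))] &&
  (ncyc_in (toggle c s) Y' == ncyc_in s Y + R s (c, false) (c, true))%N.
Proof.
move=> cY cY'; rewrite /edge_coef; case: forallP => //= H.
rewrite (ncyc_in_circles_at c cY) (ncyc_in_circles_at c cY') same_circle_toggle.
have -> : ncyc_in (toggle c s) [set h in Y' | ~~ circles_at (toggle c s) c h] =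
    ncyc_in s [set h in Y | ~~ circles_at s c h].
  rewrite -[RHS](ncyc_in_circles_off (c := c)) => [|h]; last by rewrite inE => /andP[].
  congr (ncyc_in _ _); apply/setP=> h; rewrite 2!in_set aff_toggle.
  by have := H h; case: (circles_at s c h); rewrite ?andbF // => /eqP->.
case: (R s _ _) => /=; rewrite -addnA eqn_add2l ?addn0 // addn1 //.
Qed.

Lemma ncyc_compl s Y : closed s Y -> (ncyc_in s (~: Y) + ncyc_in s Y = ncyc phi s)%N.
Proof.
move=> cY; rewrite /ncyc_in /ncyc -cardsUI -imsetU setUC setUCr.
rewrite [X in (_ + X)%N]eq_card0 ?addn0 => [|C]; last first.
  rewrite inE; apply/negP=> /andP[/imsetP[h hY ->] /imsetP[k kY /eqP]].
  rewrite eq_porbit_mem -/(R s k h) => /(closed_same cY) kh.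
  by rewrite inE -kh kY in hY.
congr #|pred_of_set _|; apply/setP=> C.
by apply/imsetP/imsetP=> -[h _ ->]; exists h.
Qed.

(** Each toggle changes the number of circles by one. For a quasi-tree this makes the numerator of
    the genus even. *)
Lemma ncyc_parity s : odd (ncyc phi s + #|s|) = odd (ncyc phi set0).
Proof.
move: {2}#|s| (erefl #|s|) => k; elim: k s => [|k IH] s sk.
  have -> : s = set0 by apply/eqP; rewrite -cards_eq0 sk.
  by rewrite cards0 addn0.
have [a aS] : exists a, a \in s by apply/set0Pn; rewrite -cards_eq0 sk.
have tE : toggle a s = s :\ a.
  by apply/setP=> i; rewrite !inE; case: eqVneq => [->|]; rewrite ?aS ?addbF.
have tk : #|s :\ a| = k by move: sk; rewrite (cardsD1 a) aS => -[].
rewrite -(IH _ tk) sk tk; have := ncyc_toggle phi a s; rewrite tE.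
by case: (R s _ _) => /=; lia.
Qed.

Lemma ncyc1_onecyc (beta : hedge n) s : (ncyc phi s == 1%N) = onecyc phi s.
Proof.
apply/idP/idP => [/cards1P[C E]|o]; last by rewrite (onecyc_ncyc beta o).
apply/onecycP=> h k; have E' x : porbit (state_perm phi s) x = C.
  by apply/set1P; rewrite -E imset_f.
by rewrite -[R s h k]/(k \in porbit (state_perm phi s) h) E' -(E' k) porbit_id.
Qed.

Lemma ncyc_in_reps beta (Q L S : {set 'I_n}) Y : onecyc phi Q ->
  (forall a, a \in L -> unlinked_below phi beta Q a) -> closed (flipped Q L) Y -> beta \in Y ->
  (forall a, a \in L -> (rep phi beta Q a \in Y) = (a \in S)) ->
  ncyc_in (flipped Q L) Y = #|L :&: S|.+1.
Proof.
move=> oQ Ll cY bY YS; set rp := rep phi beta Q.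
pose m := beta :: map rp (enum (L :&: S)).
have mE (a : 'I_n) : a \in enum (L :&: S) -> a \in L by rewrite mem_enum inE => /andP[].
rewrite cardE -(size_map rp) -[RHS]/(size m); apply/esym/transversal_size/transversalP=> h.
have [bh|[a aL ah]] := rep_cover oQ h Ll.
  rewrite -(count_same_circle _ bh) -(closed_same cY bh) bY /= same_circle_refl; apply/eqP.
  rewrite eqSS -leqn0 leqNgt -has_count; apply/hasPn=> _ /mapP[a /mE aL ->].
  exact: (rep_beta oQ Ll aL).
rewrite -(count_same_circle _ ah) -(closed_same cY ah) YS //= same_circle_sym (negPf (rep_beta oQ Ll aL)) add0n.
rewrite count_map (@eq_in_count _ _ (pred1 a)) => [|b /mE bL /=].
  by rewrite count_uniq_mem ?enum_uniq // mem_enum inE aL.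
apply/idP/eqP => [/(rep_inj oQ Ll aL bL)|->]; [by [] | exact: same_circle_refl].
Qed.

End Count.

Lemma connect_fun (T : finType) (p : {perm T}) (f : T -> T) (x y : T) :
  p =1 f -> fconnect f x y = (y \in porbit p x).
Proof.
move=> pf; apply/idP/idP.
  case/connectP=> q; elim: q x => [|z q IH] x /= => [_ ->|]; first exact: porbit_id.
  case/andP=> /eqP<- /IH{}IH /IH; rewrite -pf.
  by have := porbit_perm p 1 x; rewrite expg1 => ->.
case/porbitP=> i ->; rewrite permX (eq_iter pf).
exact: fconnect_iter.
Qed.

(** * Interleaving chords and linked edges *)

Section ChordsCross.
Variables (n : nat) (D : knot_diagram n) (col : dart n -> bool) (phi : {perm hedge n}).
Variables (beta : hedge n) (Q : {set 'I_n}).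
Hypothesis phiE : forall s h, state_perm phi s h = sigmaQ D col s h.
Hypothesis oQ : onecyc phi Q.
Local Notation f := (sigmaQ D col Q).

Lemma sigmaQ_connect h k : fconnect f h k.
Proof. by rewrite (connect_fun _ _ (phiE Q)); apply: (onecycP phi Q oQ). Qed.

(** The marks after [(a, false)] up to and including [(a, true)] form one of the two circles
    obtained by toggling [a], so comparing positions amounts to testing membership in that
    circle. *)
Lemma chords_cross_linked a b : b != a -> chords_cross D col Q a b = linked phi beta Q a b.
Proof.
move=> ba; rewrite linkedE //.
pose ix := findex f (a, false); pose k := ix (a, true).
pose P : {set hedge n} := [set h | (0 < ix h <= k)%N].
have ix0 h : (ix h == 0%N) = ((a, false) == h).
  by apply: findex_eq0.
have qP : (a, true) \in P by rewrite inE leqnn lt0n ix0 andbT; apply/eqP=> -[].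
have pP : (a, false) \notin P by rewrite inE lt0n ix0 eqxx.
have ix_inj h h' : ix h = ix h' -> h = h'.
  move=> E; rewrite -(iter_findex (sigmaQ_connect (a, false) h)) -/(ix h) E.
  exact: (iter_findex (sigmaQ_connect _ _)).
have ixS h : (ix h < k)%N -> ix (f h) = (ix h).+1.
  move=> hk; have ko : (k < fingraph.order f (a, false))%N by apply/findex_max/sigmaQ_connect.
  rewrite -[in LHS](iter_findex (sigmaQ_connect (a, false) h)) -iterS.
  by apply: findex_iter; apply: leq_ltn_trans ko.
have k0 : (0 < k)%N by move: qP; rewrite inE => /andP[].
have cP : closed phi (toggle a Q) P.
  apply: closed_sub => h; rewrite [h \in P]inE => /andP[h0 hk].
  rewrite state_perm_toggle permM phiE inE.
  suff lt : (ix (tperm (a, false) (a, true) h) < k)%N by rewrite ixS.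
  (* At its last mark [(a, true)] the toggled permutation jumps to the successor of [(a, false)], at
     position 1, which closes the arc up. *)
  have [->|hq] := eqVneq h (a, true).
    by rewrite tpermR (eqP (_ : ix (a, false) == 0%N)) ?ix0.
  rewrite tpermD //; last by rewrite eq_sym.
    by rewrite ltn_neqAle hk andbT; apply: contra hq => /eqP/ix_inj/eqP.
  by rewrite -ix0 -lt0n.
have bP x : ((b, x) \in P) = (ix (b, x) < k)%N.
  rewrite inE lt0n ix0 ltn_neqAle.
  have -> : ((a, false) == (b, x)) = false.
    by apply/eqP=> -[ab]; rewrite ab eqxx in ba.
  have -> // : ix (b, x) != k by apply/eqP=> /ix_inj[ab]; rewrite ab eqxx in ba.
have PE h : (h \in P) = same_circle phi (toggle a Q) (a, true) h.
  have := circles_at_onecyc a h oQ; rewrite circles_atE => /orP[h1|h1]; last first.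
    by rewrite -(closed_same cP h1) qP h1.
  rewrite -(closed_same cP h1) (negPf pP) same_circle_sym -(same_circle_l _ h1).
  by rewrite (negPf (onecyc_split a oQ)).
rewrite /chords_cross -/ix -/k -!bP !PE; congr (~~ _).
have [h1|h1] := boolP (same_circle phi (toggle a Q) (a, true) (b, false)).
  by rewrite -(same_circle_l _ h1) eq_sym eqb_id.
have := circles_at_onecyc a (b, false) oQ; rewrite circles_atE (negPf h1) orbF => h2.
rewrite -(same_circle_l _ h2) eq_sym eqbF_neg.
have := circles_at_onecyc a (b, true) oQ; rewrite circles_atE.
have : ~~ (same_circle phi (toggle a Q) (a, false) (b, true) && same_circle phi (toggle a Q) (a, true) (b, true)).
  apply/negP=> /andP[h3]; rewrite same_circle_sym => h4.
  by case/negP: (onecyc_split a oQ); apply: same_circle_trans h3 h4.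
by case: (same_circle _ _ _ _); case: (same_circle _ _ _ _).
Qed.

Lemma live_unlinked_below a : live D col Q a = unlinked_below phi beta Q a.
Proof.
apply: eq_forallb => b; apply: implyb_id2l => lt; congr (~~ _).
by apply: chords_cross_linked; apply: contraTneq lt => ->; rewrite ltnn.
Qed.

End ChordsCross.

(** * The reduced Khovanov complex as a cube model *)

Section KhovanovCube.
Variables (n : nat) (D : knot_diagram n) (col : dart n -> bool) (b : dart n).
Local Notation e := (kd_edge D).
Hypothesis eK : forall d, e (e d) = d.
Hypothesis colF : forall d, col (dface D d) = col d.
Hypothesis colR : forall d, col (drot d) = ~~ col d.
Local Notation phi := (diagram_perm eK colF colR).
Local Notation eta := (eta D col).
Local Notation R := (same_circle phi).
Let connE := connectE eK colF colR.

Definition kst (x : khgen D b) : {set 'I_n} := (val x).1.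
(** An enhancement records the circles labelled 1, a cube model those labelled x; hence the
    complement. *)
Definition klab (x : khgen D b) : {set hedge n} := [set h | hentry col h \notin (val x).2].

Lemma enh_okE s X : enh_ok D s X -> forall d, (d \in X) = (hentry col (eta d) \in X).
Proof.
move=> ok d.
have H d1 d2 : srel D s d1 d2 -> (d1 \in X) = (d2 \in X).
  by move=> r; apply/eqP; move/forallP/(_ d1)/forallP/(_ d2)/implyP: ok; apply.
have : connect (srel D s) d (hentry col (eta d)) by rewrite connE eta_hentry ?same_circle_refl.
case/connectP=> p pp ->; elim: p d pp => [//|x p IH] d /= /andP[/H-> /IH ->//].
Qed.

Lemma gen_ok (x : khgen D b) : enh_ok D (val x).1 (val x).2 /\ b \notin (val x).2.
Proof. by have /andP := valP x. Qed.

Lemma in_gen (x : khgen D b) d : (d \in (val x).2) = (eta d \notin klab x).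
Proof. by have [ok _] := gen_ok x; rewrite (enh_okE ok) inE negbK. Qed.

Lemma klab_closed x : closed phi (kst x) (klab x).
Proof.
apply/closedP=> h k hk; rewrite !in_set; congr (~~ _).
have [ok _] := gen_ok x.
have : connect (srel D (val x).1) (hentry col h) (hentry col k).
  by rewrite connE !eta_hentry.
case/connectP=> p pp ->; elim: p (hentry col h) pp => [//|z p IH] d /= /andP[r /IH<-].
by apply/eqP; move/forallP/(_ d)/forallP/(_ z)/implyP: ok; apply.
Qed.

Lemma scircleE s d : scircle D s d = eta @^-1: porbit (state_perm phi s) (eta d).
Proof. by apply/setP=> d'; rewrite !inE connE. Qed.

Lemma card_scircles s (X : {set dart n}) (Z : {set hedge n}) :
  (forall d, (d \in X) = (eta d \in Z)) ->
  #|[set scircle D s d | d in X]| = ncyc_in phi s Z.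
Proof.
move=> XZ; have -> : [set scircle D s d | d in X] =
    [set eta @^-1: C | C : {set hedge n} in [set porbit (state_perm phi s) h | h in Z]].
  rewrite -imset_comp; apply/setP=> C; apply/imsetP/imsetP=> -[d dX ->].
    by exists (eta d); rewrite -?XZ //= scircleE.
  by exists (hentry col d); rewrite ?XZ ?eta_hentry //= scircleE eta_hentry.
rewrite card_imset // => C C' /setP E; apply/setP=> h.
by have := E (hentry col h); rewrite !inE eta_hentry.
Qed.

Lemma ncyc_inT s : ncyc_in phi s setT = ncyc phi s.
Proof.
by congr #|pred_of_set _|; apply/setP=> C; apply/imsetP/imsetP=> -[h _ ->]; exists h.
Qed.

Lemma qdegE (x : khgen D b) : qdeg D (val x).1 (val x).2 =
  (ncyc phi (kst x))%:Z - 2%:Z * (ncyc_in phi (kst x) (klab x))%:Z.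
Proof.
rewrite /qdeg (@card_scircles _ _ (~: klab x)) => [|d]; last first.
  by rewrite in_gen in_setC.
have -> : #|scircles D (val x).1| = ncyc phi (kst x).
  rewrite -ncyc_inT -(@card_scircles _ setT) => [|d]; last by rewrite !inE.
  by congr #|pred_of_set _|; apply/setP=> C; apply/imsetP/imsetP=> -[h _ ->]; exists h.
have := ncyc_compl (klab_closed x); rewrite -/(kst x); lia.
Qed.

Lemma affectedE s i d : (d \in affected D s i) = circles_at phi s i (eta d).
Proof.
rewrite inE; apply/existsP/idP => [[k]|].
  have [x ix] : exists x, R s (eta (i, k)) (i, x).
    have go d' : col d' = false -> d'.1 = i -> exists x, eta d' = (i, x).
      by move=> cd di; rewrite etaE cd /arc_of di; eexists.
    case cd: (col (i, k)); last by have [//|x ->] := go _ cd; exists x; apply: same_circle_refl.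
    have [||x E] := go (sjoin s (i, k)) => //; first by rewrite (sjoin_color colR) cd.
    by exists x; rewrite -E; apply: eta_sjoin_same.
  rewrite connE (same_circle_l _ ix) circles_atE; case: x {ix} => ->; rewrite ?orbT //.
have go x : R s (i, x) (eta d) -> exists k, connect (srel D s) (i, k) d.
  move=> r; exists (hentry col (i, x)).2; rewrite connE.
  have -> : (i, (hentry col (i, x)).2) = hentry col (i, x) by [].
  by rewrite eta_hentry.
by rewrite circles_atE => /orP[] /go.
Qed.

(** The quantum degree of a labelled state is the number of circles minus twice the number of
    x-circles. A split adds one circle and one x, a merge removes one circle and no x; both lower it
    by one. *)
Lemma khd_cond x y i : kst y = toggle i (kst x) ->
  ((val x).2 :\: affected D (kst x) i == (val y).2 :\: affected D (kst x) i)
  && (qdeg D (kst y) (val y).2 == qdeg D (kst x) (val x).2 - 1) =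
  edge_coef phi (kst x) i (klab x) (klab y).
Proof.
move=> sy; have cy := klab_closed y; rewrite sy in cy.
rewrite (edge_coef_count (klab_closed x) cy); congr (_ && _).
  apply/eqP/forallP => [E h|H].
    apply/implyP=> nh; have /setP/(_ (hentry col h)) := E.
    rewrite !in_setD !affectedE !in_gen !eta_hentry // nh /=.
    by case: (_ \in _); case: (_ \in _).
  apply/setP=> d; rewrite !in_setD !affectedE !in_gen.
  by have := H (eta d); case: (circles_at _ _ _ _) => //= /eqP->.
rewrite !qdegE sy; have := ncyc_toggle phi i (kst x).
by case: (R _ _ _) => /= E; apply/eqP/eqP; lia.
Qed.

Lemma khd_model : cube_model phi (eta b) kst klab (@khd n D b).
Proof.
split.
- exact: klab_closed.
- by move=> y; have [_] := gen_ok y; rewrite in_gen negbK.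
- move=> y z es el; apply: val_inj.
  have E : (val y).2 = (val z).2 by apply/setP=> d; rewrite !in_gen el.
  by rewrite [val y]surjective_pairing E [(val y).1]es -surjective_pairing.
- move=> s Y cY bY; pose X : {set dart n} := [set d | eta d \notin Y].
  have ok : enh_ok D s X && (b \notin X).
    rewrite /X inE negbK bY andbT; apply/forallP=> d; apply/forallP=> d'; apply/implyP.
    move=> r; rewrite !inE (closed_same cY (_ : R s (eta d) (eta d'))) //.
    by rewrite -connE; apply: connect1.
  exists (exist _ (s, X) ok); split=> //; apply/setP=> h.
  by rewrite inE /= /X inE eta_hentry; case: (h \in Y).
- move=> x y i ix sy; rewrite /khd -/(kst x) -/(kst y); case: pickP => [j|no].
    case/andP=> jx /eqP E; have ij : j = i.
      have : j \in toggle i (kst x) by rewrite -sy E setU11.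
      by rewrite toggleU // !inE (negPf jx) orbF => /eqP.
    by rewrite ij khd_cond //; case: edge_coef; rewrite ?mulr1 ?mulr0.
  by have := no i; rewrite ix sy toggleU // eqxx.
- move=> x y; rewrite /khd -/(kst x) -/(kst y).
  case: pickP => [i /andP[ix /eqP E] _|]; last by rewrite eqxx.
  by exists i; rewrite toggleU.
Qed.

End KhovanovCube.

(** * Gradings of the critical generators *)

Section Degrees.
Variables (n : nat) (D : knot_diagram n) (col : dart n -> bool) (b : dart n).
Local Notation e := (kd_edge D).
Hypothesis eK : forall d, e (e d) = d.
Hypothesis colF : forall d, col (dface D d) = col d.
Hypothesis colR : forall d, col (drot d) = ~~ col d.
Hypothesis einc : forall d, incoming D (e d) = ~~ incoming D d.
Hypothesis one_comp : forall d d', incoming D d -> incoming D d' ->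
  fconnect (dstrand D) d d'.
Local Notation phi := (diagram_perm eK colF colR).
Local Notation beta := (eta D col b).
Local Notation K := (khgen D b).
Local Notation st := (@kst n D b).
Local Notation lab := (@klab n D col b).

Lemma norbits_porbits (f : hedge n -> hedge n) (p : {perm hedge n}) :
  p =1 f -> norbits f = #|porbits p|.
Proof.
move=> pf; rewrite /norbits /nclasses; congr #|pred_of_set _|.
have E h : [set k | connect (frel f) h k] = porbit p h.
  by apply/setP=> k; rewrite inE (connect_fun _ _ pf).
by apply/setP=> C; apply/imsetP/imsetP=> -[h _ ->]; exists h.
Qed.

Lemma nfacesE Q : nfaces D col Q = ncyc phi Q.
Proof. by apply: norbits_porbits => h; apply: state_perm_sigmaQ. Qed.

Lemma nvertE : nvert D col = ncyc phi set0.
Proof. by apply: norbits_porbits => h; rewrite state_perm_sigmaQ /sigmaQ inE. Qed.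

Lemma quasi_treeE Q : quasi_tree D col Q = onecyc phi Q.
Proof. by rewrite /quasi_tree nfacesE (ncyc1_onecyc _ beta). Qed.

Lemma khd_deg (x y : K) : khd x y != 0 -> khi y = khi x + 1 /\ khj y = khj x.
Proof.
have M := khd_model b eK colF colR.
move=> dxy; have [i [ix sy]] := cube_non_edge M dxy.
have := dxy; rewrite (cube_edge M ix sy) -khd_cond //.
case: andP => [[_ /eqP qE] _|]; last by rewrite mulr0 eqxx.
have cs : #|kst y| = #|kst x|.+1 by rewrite sy toggleU // cardsU1 ix.
rewrite /khi /khj -/(kst x) -/(kst y) qE cs; split; lia.
Qed.

Lemma genus_double Q : onecyc phi Q ->
  2%:Z * genus D col Q = 1 - (nvert D col)%:Z + #|Q|%:Z.
Proof.
move=> oQ; have := ncyc_parity phi Q; rewrite (onecyc_ncyc beta oQ) -nvertE /genus.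
move: #|Q| (nvert D col) => a v par; lia.
Qed.

(** The state has [#|L| + 1] circles, of which [#|L :&: Q| + 1] carry x, so [qdeg] is [u - 1]; the
    base circle accounts for the constant in the formula for [u]. The number of B-smoothings is
    [#|Q| + u], from which the formula for [v] follows. *)
Lemma crit_deg (y : K) : Ncrit phi beta st lab y = set0 ->
  deg_corr D col (qt_u D col (Qof phi beta st y)) (qt_v D col (Qof phi beta st y))
    (khi y) (khj y).
Proof.
have M := khd_model b eK colF colR; have conn := onecyc_ex eK colF colR einc one_comp.
set Q := Qof _ _ _ y; have [oQ _] := QofP beta st conn y; rewrite -/Q in oQ.
case/(crit_Lof conn)=> eL lY; set L := Lof phi beta st y in eL lY.
have sy : kst y = flipped Q L by apply: stE.
have Ll a : a \in L -> unlinked_below phi beta Q a by rewrite eL inE.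
have liveE a : live D col Q a = (a \in L).
  by rewrite eL inE; apply: live_unlinked_below oQ _ => s h; apply: state_perm_sigmaQ.
have cY : closed phi (flipped Q L) (klab col y) by rewrite -sy; apply: klab_closed.
have bY : beta \in klab col y by apply: (cube_base M).
have xc := ncyc_in_reps oQ Ll cY bY (fun a aL => lY a aL).
have nc := ncyc_flipped oQ Ll.
rewrite /deg_corr /qt_u /qt_v /khi /khj (qdegE eK colF colR) -/(kst y) sy xc nc.
have g2 : 2%:Z * genus D col Q = 1 - (nvert D col)%:Z + #|Q|%:Z := genus_double oQ.
have uE : #|[set a | live D col Q a & a \notin Q]| = #|L :\: Q|.
  by apply: eq_card => a; rewrite in_set in_setD liveE andbC.
have iE : #|[set a | live D col Q a & a \in Q]| = #|L :&: Q|.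
  by apply: eq_card => a; rewrite in_set in_setI liveE.
have sE : (#|flipped Q L| + #|L :&: Q| = #|Q| + #|L :\: Q|)%N.
  have -> : flipped Q L = (Q :\: L) :|: (L :\: Q).
    by apply/setP=> a; rewrite in_set in_setU !in_setD; case: (a \in Q); case: (a \in L).
  rewrite cardsU -(cardsID L Q) [Q :&: L]setIC.
  have -> : (Q :\: L) :&: (L :\: Q) = set0.
    by apply/setP=> a; rewrite in_setI !in_setD in_set0; case: (a \in Q); rewrite ?andbF.
  by rewrite cards0; lia.
have lE : (#|L| = #|L :&: Q| + #|L :\: Q|)%N by rewrite cardsID.
have npn : (nplus D <= n)%N by rewrite -[X in (_ <= X)%N]card_ord max_card.
rewrite uE iE; move: g2.
move: sE lE npn; rewrite /writhe /nminus.
move: #|flipped Q L| #|L :&: Q| #|L :\: Q| #|L| #|Q| (nplus D) (nvert D col) (genus D col Q).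
move=> x1 x2 x3 x4 x5 p v g e1 e2 e3 e4.
by apply/andP; split; apply/eqP; lia.
Qed.

End Degrees.

Theorem theorem2 (n : nat) (D : knot_diagram n) (c : dart n -> bool)
  (b : dart n) :
  is_knot_diagram D -> checkerboard D c ->
  exists dC : qtree D c -> qtree D c -> int,
    (forall Q Q', dC Q Q' != 0 ->
       qu Q' = qu Q - 1 /\ qv Q' = qv Q - 1) /\
    (forall Q Q', lcomp dC dC Q Q' = 0) /\
    deformation_retract dC (@khd n D b)
      (fun Q x => deg_corr D c (qu Q) (qv Q) (khi x) (khj x))
      (fun x y => (khi y == khi x - 1) && (khj y == khj x)) /\
    (forall i j u v : int, deg_corr D c u v i j ->
       homology_iso (@khd n D b)
         [pred x | (khi x == i) && (khj x == j)]
         dC [pred Q | (qu Q == u) && (qv Q == v)]).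
Proof.
case=> eK _ einc one_comp _ [colF colR _].
set ph := diagram_perm eK colF colR; set beta := eta D c b.
have M := khd_model b eK colF colR.
have conn := onecyc_ex eK colF colR einc one_comp.
have [Q0 oQ0] := conn; have [y0 _] := crit_ex M conn oQ0.
pose st := @kst n D b; pose lab := @klab n D c b.
have oC (Q : qtree D c) : onecyc ph (val Q).
  by have := valP Q; rewrite (quasi_treeE b eK colF colR).
pose crit (Q : qtree D c) := critgen ph beta st lab (val Q) y0.
have critP' Q : Qof ph beta st (crit Q) = val Q /\ Ncrit ph beta st lab (crit Q) = set0.
  exact: (critgenP M conn y0 (oC Q)).
have crit_inj : injective crit.
  move=> Q Q' E; apply: val_inj; have [<- _] := critP' Q; rewrite E.
  by have [-> _] := critP' Q'.
have corr Q : deg_corr D c (qu Q) (qv Q) (khi (crit Q)) (khj (crit Q)).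
  have [QE NE] := critP' Q.
  by have := crit_deg einc one_comp NE; rewrite QE.
have cP x : reflect (exists a, crit a = x)
    (~~ lowgen ph beta st lab x && ~~ highgen ph beta st lab x).
  rewrite neither; apply: (iffP eqP) => [Nx|[Q <-]]; last by have [] := critP' Q.
  have [oQ _] := QofP beta st conn x.
  have qQ : quasi_tree D c (Qof ph beta st x) by rewrite (quasi_treeE b eK colF colR).
  pose Qx : qtree D c := Sub (Qof ph beta st x) qQ.
  exists Qx; have [QE NE] := critP' Qx.
  exact: (crit_uniq M conn QE NE Nx).
have dd x y : lcomp (@khd n D b) (@khd n D b) x y = 0 by apply: cube_dd M x y.
pose deg (x : khgen D b) : (int * int)%type := (khi x, khj x).
have d_deg (x y : khgen D b) : khd x y != 0 -> deg y = deg x + (1, 0).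
  by move/(khd_deg eK colF colR) => [e1 e2]; rewrite /deg e1 e2; congr (_, _); rewrite addr0.
have [dC [f [g [h [dC2 [r1 r2 r3 r4] [g1 g2 g3 g4]]]]]] :=
  morse_retract dd (@low_not_high _ ph beta _ st lab) (mate_low M conn)
   (mate_high M conn) (mateK M conn) (d_mate M conn)
   (gen_lt_irr ph beta st lab) (@gen_lt_trans _ ph beta _ st lab) (d_gen_lt M conn)
   crit_inj cP d_deg.
have retr : deformation_retract dC (@khd n D b)
    (fun Q x => deg_corr D c (qu Q) (qv Q) (khi x) (khj x))
    (fun x y => (khi y == khi x - 1) && (khj y == khj x)).
  exists f, g, h; split=> [Q x /g2[-> ->]|]; first exact: corr.
  split=> [x Q /g3[-> ->]|]; first exact: corr.
  split=> [x y /g4[-> ->]|]; first by rewrite subr0 !eqxx.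
  by do 3 (split; first exact).
exists dC; split; last split; last split=> //.
(* Raising [i] by one with [j] fixed lowers [j - i] by one and [j - 2 * i] by two, hence [u] and [v]
   by one each. *)
- move=> Q Q' /g1[e1 e2]; have := corr Q'; have := corr Q.
  rewrite /deg_corr e1 e2 => /andP[/eqP u1 /eqP v1] /andP[/eqP u2 /eqP v2].
  by split; lia.
- exact: dC2.
move=> i j u v /andP[/eqP u1 /eqP v1].
(* The relation between [(u, v)] and [(i, j)] is linear and invertible, so fixing either pair fixes
   the other. *)
apply: (retract_homology retr) => Q x /andP[/eqP u2 /eqP v2] /=.
apply/andP/andP=> -[/eqP e1 /eqP e2]; split; apply/eqP; lia.
Qed.
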